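(* Let $p$ be a prime and $K$ a finite extension of $\mathbb{Q}_p$. Suppose one of the following: (1) $\pi\in\mathcal{M}_K\setminus\{0\}$, $h(T)=h(T;\pi)$, $\rho=|\pi|$, and $\kappa$ is a partition with $\kappa_1+l(\kappa)\le p$. (2) $g$ is an integer with $0<g<p$, $\vec{\pi}=(\pi_i)_{i=1}^g\in\mathcal{M}_K^{\oplus g}$ with $|\pi_i|\le|\pi_g|$ for all $i=1,2,\ldots,g-1$; $\boldsymbol{\mu}=(1,2,\ldots,g)$, $h(T)=h_{\boldsymbol{\mu}}(T;\vec{\pi})$, $\rho=|\pi_g|^{1/g}$, and $\kappa=(g,0,0,\ldots)$. Then $h(T)\in\Gamma_+\cap\Gamma_\rho$ and $|S_\kappa(h(T))|=\rho^{|\kappa|}$. Consequently, $h(T)W^{\mathrm{alg}}\cap T^{-i(W^{\mathrm{alg}})}K[[\frac1T]]=0$ for any $W\in\mathrm{Gr}^{\mathrm{an}}(K)$ such that $W^{\mathrm{alg}}$ is strictly integral and $\kappa=\kappa(W^{\mathrm{alg}})$.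
   Context: $|\cdot|$ is the absolute value on $K$ with $|p|=1/p$, $O_K=\{a\in K:|a|\le1\}$, $\mathcal{M}_K=\{a\in K:|a|<1\}$. Partitions and Schur functions: a partition is a non-increasing sequence $\kappa=(\kappa_i)_{i\ge1}$ of non-negative integers, eventually $0$; $l(\kappa)$ is the number of nonzero terms and $|\kappa|=\sum\kappa_i$. For $h(T)=\sum_{i\ge0}h_iT^i$ with $h_0=1$ (and $h_i=0$ for $i<0$), $S_\kappa(h):=\det(h_{\kappa_i-i+j})_{i,j=1}^{l(\kappa)}$. Loops: $l(T):=\sum_{k\ge0}p^{-k}T^{p^k}$, $h(T;\pi):=\exp(l(\pi T))$ for $\pi\in\mathcal{M}_K$, and $h_{\boldsymbol{\mu}}(T;\vec{\pi}):=\prod_{i=1}^gh(T^{\mu_i};\pi_i)$ for a sequence of positive integers $\boldsymbol{\mu}=(\mu_1,\ldots,\mu_g)$ and $\vec{\pi}\in\mathcal{M}_K^{\oplus g}$. $H:=\{\sum_{i\in\mathbb{Z}}a_iT^i : a_i\in K,\ \sup|a_i|<\infty,\ \lim_{i\to+\infty}|a_i|=0\}$, a field, with norm $\|\sum a_iT^i\|=\sup|a_i|$. $H_+$ (resp. $H_-$) is the closed subspace of series with $a_i=0$ for $i\le0$ (resp. $i>0$). For $0\le\rho<1$, $\Gamma_\rho:=\{h=\sum h_iT^i\in H^* : \|h\|=|h_0|=1,\ |h_i|\le\rho^i\ \forall i>0\}$; $\Gamma:=\bigcup_{0\le\rho<1}\Gamma_\rho$; $\Gamma_+:=\{h\in\Gamma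 : h_0=1,\ h_i=0\ \forall i<0\}$. Algebraic Grassmannian: $K((\frac1T))$ is the field of series $\sum_{i\le n}v_iT^i$; the degree is the largest exponent with nonzero coefficient, and a series is monic if its leading coefficient is $1$. For a $K$-subspace $V$ put $\underline{M}(V)=\{\deg v : 0\ne v\in V\}$. $\mathrm{Gr}^{\mathrm{alg}}(K)$ is the set of $K$-subspaces $V$ for which $V\cap K[[\frac1T]]$ and $K((\frac1T))/(V+K[[\frac1T]])$ are finite dimensional. For such $V$ write $\underline{M}(V)=\{s_1<s_2<\cdots\}$; the index is $i(V)=|\underline{M}(V)\cap\mathbb{Z}_{\le0}|-|\mathbb{Z}_{>0}\setminus\underline{M}(V)|$ and the partition $\kappa(V)$ is given by $\kappa_j(V)=j-i(V)-s_j$. The standard basis of $V$ is the unique basis $v_i(T)=\sum_jv_{ij}T^j$ ($i\ge1$) with $v_i$ monic of degree $s_i$ and $v_{i,s_j}=0$ for $i>j\ge1$. $V$ is strictly integral if all coefficients $v_{ij}$ lie in $O_K$. $p$-adic Grassmannian: $\mathrm{Gr}^{\mathrm{an}}(K)$ is the set of $K$-subspaces $W\subset H$ that are the image of an injective $K$-linear map $w:H_+\to H$ such that, for some $i_0\in\mathbb{Z}$, $T^{i_0}w=w_1\oplus(1+w_2):H_+\to H_-\oplus H_+=H$ with $w_1:H_+\to H_-$ $K$-linear, $\|w_1\|\le1$, and $w_2:H_+\to H_+$ $K$-linear, $\|w_2\|\le1$, a uniform limit of bounded finite-rank operators. For $W\in\mathrm{Gr}^{\mathrm{an}}(K)$,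 $W^{\mathrm{alg}}:=W\cap K((\frac1T))$ (intersection in $\prod_{i\in\mathbb{Z}}KT^i$), which is an element of $\mathrm{Gr}^{\mathrm{alg}}(K)$. $\Gamma$ acts on $\mathrm{Gr}^{\mathrm{an}}(K)$ by multiplication, and $h(T)W^{\mathrm{alg}}:=(h(T)W)^{\mathrm{alg}}$.
   Formalization: The final conclusion h(T)W^alg ∩ T^{-i(W^alg)}K[[1/T]] = 0 is stated only for ρ > 0, i.e. π_g ≠ 0 in case (2); for π_g = 0 one has h = 1 and the claim fails, e.g. for W the closed span of T^{1-g}, T^2, T^3, …. *)

(* Defs.v *)
From HB Require Import structures.
From mathcomp Require Import all_boot all_order all_algebra all_field.
From mathcomp Require Import finmap.
From mathcomp Require Import all_classical all_reals.
From mathcomp Require Import topology normedtype sequences exp.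

Set Implicit Arguments.
Unset Strict Implicit.
Unset Printing Implicit Defensive.

Import Order.TTheory GRing.Theory Num.Theory.
Import numFieldNormedType.Exports.

Local Open Scope classical_set_scope.
Local Open Scope ring_scope.

Section AbsoluteValues.
Variable R : realType.

Record nonarch_absval (F : fieldType) (abs : F -> R) : Prop := NonarchAbsval {
  absval_ge0 : forall x, 0 <= abs x;
  absval_eq0 : forall x, abs x = 0 <-> x = 0;
  absvalM : forall x y, abs (x * y) = abs x * abs y;
  absvalD : forall x y, abs (x + y) <= Num.max (abs x) (abs y)
}.

Definition abs_cvg (F : fieldType) (abs : F -> R) (u : nat -> F) (l : F) : Prop :=
  abs (u n - l) @[n --> \oo] --> (0 : R).

Definition abs_cauchy (F : fieldType) (abs : F -> R) (u : nat -> F) : Prop :=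
  forall e : R, 0 < e ->
    exists N, forall m n, (N <= m)%N -> (N <= n)%N -> abs (u m - u n) < e.

Definition padic_abs_rat (p : nat) (q : rat) : R :=
  if q == 0 then 0
  else p%:R ^ ((logn p `|denq q|%N)%:Z - (logn p `|numq q|%N)%:Z).

(* [(Qp, absQ)] is the completion of the rationals for the p-adic absolute
   value; this determines it up to a unique isometric isomorphism. *)
Record padic_completion (p : nat) (Qp : fieldType) (absQ : Qp -> R) : Prop :=
  PadicCompletion {
  padic_absval : nonarch_absval absQ;
  padic_ratr : forall q : rat, absQ (ratr q) = padic_abs_rat p q;
  padic_dense : forall (x : Qp) (e : R), 0 < e ->
    exists q : rat, absQ (x - ratr q) < e;
  padic_complete : forall u : nat -> Qp, abs_cauchy absQ u ->
    exists l, abs_cvg absQ u l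
}.

Record absval_extension (Qp : fieldType) (absQ : Qp -> R)
    (K : fieldExtType Qp) (abs : K -> R) : Prop := AbsvalExtension {
  ext_absval : nonarch_absval abs;
  ext_restr : forall x : Qp, abs (x%:A) = absQ x
}.

End AbsoluteValues.

(* A partition is the sequence of its nonzero terms: [l(kappa)] is [size kappa],
   [|kappa|] is [sumn kappa], and the (i+1)-st term is [nth 0 kappa i]. *)
Definition is_partition (kappa : seq nat) : bool :=
  sorted geq kappa && (0%N \notin kappa).

Section PowerSeries.
Variable K : fieldType.

Definition ps_one : nat -> K := fun n => (n == 0%N)%:R.

Definition ps_mul (f g : nat -> K) : nat -> K :=
  fun n => \sum_(i < n.+1) f i * g (n - i)%N.

(* For [f 0 = 0] only the powers [f ^ k] with [k <= n] contribute to the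
   coefficient of [T ^ n]. *)
Definition ps_exp (f : nat -> K) : nat -> K :=
  fun n => \sum_(k < n.+1) (k`!%:R)^-1 * iter k (ps_mul f) ps_one n.

(* f(a T) *)
Definition ps_dilate (a : K) (f : nat -> K) : nat -> K := fun n => a ^+ n * f n.

(* f(T ^ m), for m > 0 *)
Definition ps_inflate (m : nat) (f : nat -> K) : nat -> K :=
  fun n => if (m %| n)%N then f (n %/ m)%N else 0.

(* The bound on [k] is harmless, since [k < p ^ k]. *)
Definition ps_l (p : nat) : nat -> K :=
  fun n => \sum_(k < n.+1 | (p ^ k == n)%N) (p%:R)^-1 ^+ k.

Definition ps_h (p : nat) (pi : K) : nat -> K := ps_exp (ps_dilate pi (ps_l p)).

Definition ps_hmu (p : nat) (mu : seq nat) (pi : seq K) : nat -> K :=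
  \big[ps_mul/ps_one]_(i < size mu) ps_inflate (nth 0%N mu i) (ps_h p pi`_i).

End PowerSeries.

(* The product of the lines K T^i, i in Z. *)
Notation zseries K := (int -> K^o).

Section Series.
Variable K : fieldType.

Definition zseries_of_ps (f : nat -> K) : zseries K :=
  fun i => if i is Posz n then f n else 0.

Definition schur (kappa : seq nat) (h : zseries K) : K :=
  \det (\matrix_(i < size kappa, j < size kappa)
          (h ((nth 0%N kappa i)%:Z - i%:Z + j%:Z) : K)).

Definition shiftT (m : int) (u : zseries K) : zseries K := fun j => u (j - m).

(* K((1/T)) *)
Definition laurent : set (zseries K) :=
  [set u | exists n : int, forall j, n < j -> u j = 0].

(* K[[1/T]] *)
Definition taylor : set (zseries K) := [set u | forall j, 0 < j -> u j = 0].

Definition has_degree (u : zseries K) (d : int) : Prop :=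
  u d <> 0 /\ forall j, d < j -> u j = 0.

Definition degrees (V : set (zseries K)) : set int :=
  [set d | exists2 u, V u & has_degree u d].

(* s_1 < s_2 < ...; numbered from zero: [deg_enum V j] is s_(j+1). *)
Definition deg_enum (V : set (zseries K)) : nat -> int :=
  xget (fun=> 0) [set s : nat -> int |
    (forall i j : nat, (i < j)%N -> s i < s j) /\ range s = degrees V].

Definition gr_index (V : set (zseries K)) : int :=
  #|` fset_set (degrees V `&` [set d | d <= 0]) |%:Z -
  #|` fset_set ([set d | 0 < d] `\` degrees V) |%:Z.

(* [kappa_of V j] is kappa_(j+1)(V). *)
Definition kappa_of (V : set (zseries K)) (j : nat) : int :=
  j.+1%:Z - gr_index V - deg_enum V j.

Record is_basis (V : set (zseries K)) (v : nat -> zseries K) : Prop := IsBasis {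
  basis_mem : forall i, V (v i);
  basis_free : forall n (c : 'I_n -> K),
    \sum_(i < n) c i *: v i = 0 -> forall i, c i = 0;
  basis_span : forall u, V u ->
    exists n (c : 'I_n -> K), u = \sum_(i < n) c i *: v i
}.

Record standard_basis (V : set (zseries K)) (v : nat -> zseries K) : Prop :=
  StandardBasis {
  stdb_basis : is_basis V v;
  stdb_degree : forall i, has_degree (v i) (deg_enum V i);
  stdb_monic : forall i, v i (deg_enum V i) = 1;
  stdb_reduced : forall i j, (j < i)%N -> v i (deg_enum V j) = 0
}.

End Series.

Section Analytic.
Variables (R : realType) (K : fieldType) (abs : K -> R).

Definition Hspace : set (zseries K) :=
  [set a | (exists B : R, forall i, abs (a i) <= B) /\
           abs (a n%:Z) @[n --> \oo] --> (0 : R)].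

Definition Hplus : set (zseries K) :=
  [set a | Hspace a /\ forall i, i <= 0 -> a i = 0].

Definition Hminus : set (zseries K) :=
  [set a | Hspace a /\ forall i, 0 < i -> a i = 0].

Definition normH (a : zseries K) : R := sup (range (fun i => abs (a i))).

(* The coefficient of [T ^ n] is the sum over all i in Z of [a_i b_(n-i)],
   as the limit of the sums over -N <= i <= N; it converges for a, b in
   [Hspace]. *)
Definition mulH (a b : zseries K) : zseries K := fun n =>
  xget 0 [set l : K | abs_cvg abs
    (fun N : nat => \sum_(k < N.*2.+1)
       (a (k%:Z - N%:Z) : K) * b (n - (k%:Z - N%:Z))) l].

Definition Gamma_rho (rho : R) : set (zseries K) :=
  [set h | [/\ Hspace h, h <> 0, normH h = 1, abs (h 0) = 1 &
            forall i : nat, (0 < i)%N -> abs (h i%:Z) <= rho ^+ i]].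

Definition Gamma : set (zseries K) :=
  [set h | exists rho : R, 0 <= rho < 1 /\ Gamma_rho rho h].

Definition Gamma_plus : set (zseries K) :=
  [set h | [/\ Gamma h, h 0 = 1 & forall i, i < 0 -> h i = 0]].

Definition strictly_integral (V : set (zseries K)) : Prop :=
  exists2 v, standard_basis V v & forall i j, abs (v i j) <= 1.

(* A K-linear map from Hplus to S, as a function on all of [zseries K] of which only
   the values on Hplus matter. *)
Definition linear_on_Hplus (S : set (zseries K)) (w : zseries K -> zseries K) :=
  (forall x, Hplus x -> S (w x)) /\
  (forall (c : K) x y, Hplus x -> Hplus y -> w (c *: x + y) = c *: w x + w y).

Definition opnorm_le (w : zseries K -> zseries K) (C : R) : Prop :=
  forall x, Hplus x -> normH (w x) <= C * normH x.

Definition finite_rank (w : zseries K -> zseries K) : Prop :=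
  exists n (b : 'I_n -> zseries K), forall x, Hplus x ->
    exists c : 'I_n -> K, w x = \sum_i c i *: b i.

Definition limit_of_finite_rank (w : zseries K -> zseries K) : Prop :=
  exists F : nat -> zseries K -> zseries K,
    (forall n, [/\ linear_on_Hplus Hplus (F n), exists C, opnorm_le (F n) C &
                finite_rank (F n)]) /\
    (forall e : R, 0 < e -> exists N, forall n, (N <= n)%N ->
       opnorm_le (fun x => w x - F n x) e).

Definition Gr_an : set (set (zseries K)) :=
  [set W | exists w : zseries K -> zseries K,
    [/\ linear_on_Hplus Hspace w,
        forall x y, Hplus x -> Hplus y -> w x = w y -> x = y,
        W = w @` Hplus &
        exists (i0 : int) (w1 w2 : zseries K -> zseries K),
          [/\ linear_on_Hplus Hminus w1 /\ opnorm_le w1 1,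
              linear_on_Hplus Hplus w2 /\ opnorm_le w2 1,
              limit_of_finite_rank w2 &
              forall x, Hplus x -> shiftT i0 (w x) = w1 x + (x + w2 x)]]].

Definition alg_part (W : set (zseries K)) : set (zseries K) := W `&` @laurent K.

Definition loop_act (h : zseries K) (W : set (zseries K)) : set (zseries K) :=
  mulH h @` W.

End Analytic.

(* Main.v *)
(** The Artin-Hasse series [E = exp l] satisfies Dwork's equation
    [E(T)^p = E(T^p) exp(p T)]; comparing coefficients modulo [p] shows by induction
    that [E] has p-integral coefficients, whence [|h_n| <= rho^n].  In case (1) the
    entries of the Schur determinant are [pi^m / m!] with [m < p], and the determinant
    is a Vandermonde one in the distinct numbers [kappa_i + l - i < p]; in case (2) it
    is [h_g = pi_g + O(|pi_g|^2)].

    For the transversality, [W] is closed: [1 + w2] is isometric on the kernel of a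
    finite rank approximation of [w2], a subspace of finite codimension.  Hence every
    [x] in [W] is the convergent sum of the [x(s_j) v_j], [v] being the standard basis
    of the algebraic part.  If [h x] has no coefficient above [T^(-i)], Cramer's rule
    with [|S_kappa(h)| = rho^|kappa|] bounds all [|x(s_j)| rho^(-s_j)] by the supremum
    [X] of [|x(t)| rho^(-t)] over the positions [t] that are not degrees.  The
    expansion, where [x(t)] only involves the [x(s_j)] with [s_j > t], gives back
    [X <= rho X], so that [x = 0]. *)

Require Import Defs.
From HB Require Import structures.
From mathcomp Require Import all_boot all_order all_algebra all_field.
From mathcomp Require Import finmap.
From mathcomp Require Import all_classical all_reals.
From mathcomp Require Import topology normedtype sequences exp.
From mathcomp Require Import fingroup perm ring lra zify.

Set Implicit Arguments.
Unset Strict Implicit.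
Unset Printing Implicit Defensive.

Import Order.TTheory GRing.Theory Num.Theory.
Import numFieldNormedType.Exports.

Local Open Scope classical_set_scope.
Local Open Scope ring_scope.


(** * Non-archimedean absolute values and completeness *)

(** Integrality of E is proved over Q_p and only then carried over to K: the argument needs x^p = x
    modulo p, which can fail for integral elements of K.

    An element of W may involve infinitely many positive powers of T, so it need not be a finite
    combination of the v_j. This is why W has to be complete: the infinite sum must land in W again
    before it can be compared with x.

    The bounds |h_n| <= rho^n alone give |S_kappa(h)| <= rho^|kappa|. Equality means that Cramer's
    rule loses nothing in the weighted norm, so the single factor rho gained from the expansion is a
    strict contraction. That factor is there because a position t that is not a degree lies at least
    1 below any s_j > t.

    [normH] and [mulH] are a supremum and a chosen limit, with default values when these do not
    exist; estimates are therefore made coefficient by coefficient. *)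

Section AbsBasics.
Variables (R : realType) (F : fieldType) (abs : F -> R).
Hypothesis absP : nonarch_absval abs.

Lemma abs_ge0 x : 0 <= abs x.
Proof. exact: absval_ge0 absP x. Qed.

Lemma abs0 : abs 0 = 0.
Proof. exact/(absval_eq0 absP). Qed.

Lemma abs_gt0 x : x != 0 -> 0 < abs x.
Proof.
move=> x0; rewrite lt_def abs_ge0 andbT; apply: contra x0 => /eqP.
by move/(absval_eq0 absP) => ->.
Qed.

Lemma absM x y : abs (x * y) = abs x * abs y.
Proof. exact: absvalM absP x y. Qed.

Lemma abs1 : abs 1 = 1.
Proof.
have /mulfI : abs 1 != 0 by rewrite gt_eqF // abs_gt0 ?oner_neq0.
by apply; rewrite -absM !mulr1.
Qed.

Lemma absX x n : abs (x ^+ n) = abs x ^+ n.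
Proof. by elim: n => [|n IH]; rewrite ?abs1 // !exprS absM IH. Qed.

Lemma absV x : abs x^-1 = (abs x)^-1.
Proof.
have [->|x0] := eqVneq x 0; first by rewrite invr0 abs0 invr0.
have a0 : abs x != 0 by rewrite gt_eqF // abs_gt0.
by apply: (mulfI a0); rewrite -absM !mulfV // abs1.
Qed.

Lemma absN x : abs (- x) = abs x.
Proof.
have sq : abs (-1) ^+ 2 = 1 by rewrite -absX sqrrN expr1n abs1.
have a1 : abs (-1) = 1.
  by apply/eqP; rewrite -(@eqrXn2 _ 2) ?abs_ge0 ?sq ?expr1n.
by rewrite -mulN1r absM a1 mul1r.
Qed.

Lemma absD_le x y e : abs x <= e -> abs y <= e -> abs (x + y) <= e.
Proof.
by move=> xe ye; apply: le_trans (absvalD absP x y) _; rewrite ge_max xe.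
Qed.

Lemma absB_le x y e : abs x <= e -> abs y <= e -> abs (x - y) <= e.
Proof. by move=> xe ye; apply: absD_le; rewrite ?absN. Qed.

Lemma abs_sum_le (I : Type) (r : seq I) (P : pred I) (f : I -> F) e :
  0 <= e -> (forall i, P i -> abs (f i) <= e) ->
  abs (\sum_(i <- r | P i) f i) <= e.
Proof.
move=> e0 fe; elim/big_ind: _ => //; first by rewrite abs0.
by move=> x y; exact: absD_le.
Qed.

Lemma abs_prod (I : Type) (r : seq I) (P : pred I) (f : I -> F) :
  abs (\prod_(i <- r | P i) f i) = \prod_(i <- r | P i) abs (f i).
Proof. by elim/big_rec2: _ => [|i y1 y2 _ <-]; rewrite ?abs1 // absM. Qed.

Lemma abs_nat_le1 n : abs n%:R <= 1.
Proof. by elim: n => [|n IH]; rewrite ?abs0 // -natr1 absD_le ?abs1. Qed.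

Lemma abs_int_le1 (n : int) : abs n%:~R <= 1.
Proof.
case: n => n; first exact: abs_nat_le1.
by rewrite NegzE mulrNz absN; exact: abs_nat_le1.
Qed.

Lemma absD_dominant x y : abs y < abs x -> abs (x + y) = abs x.
Proof.
move=> yx; apply/eqP; rewrite eq_le absD_le ?(ltW yx) //=.
rewrite leNgt; apply/negP => xyx.
have : abs x <= Num.max (abs (x + y)) (abs y).
  by rewrite -{1}(addrK y x); apply: absB_le; rewrite le_max lexx ?orbT.
by rewrite le_max !leNgt xyx yx.
Qed.

(** Serves to pass to a limit, an ultrametric error d appearing under the maximum. For e > 0 the
    choice d = e is enough; only e = 0 needs arbitrarily small d. *)
Lemma abs_le_eps x e : (forall d, 0 < d -> abs x <= Num.max e d) -> 0 <= e ->
  abs x <= e.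
Proof.
rewrite le_eqVlt => H /predU1P[e0|e0].
  rewrite -e0 in H *; apply/ler_addgt0Pr => d d0; rewrite add0r.
  by apply: le_trans (H _ d0) _; rewrite ge_max lexx andbT ltW.
by have := H _ e0; rewrite maxxx.
Qed.

Lemma eq0_abs_le x : (forall e, 0 < e -> abs x <= e) -> x = 0.
Proof.
move=> H; apply/(absval_eq0 absP)/eqP; rewrite eq_le abs_ge0 andbT.
by apply/ler_addgt0Pr => e e0; rewrite add0r; exact: H.
Qed.

Lemma abs_cvgP u l : abs_cvg abs u l <->
  forall e, 0 < e -> exists N, forall n, (N <= n)%N -> abs (u n - l) <= e.
Proof.
split.
  move/cvgr0Pnorm_le => H e e0; have [N _ HN] := H _ e0.
  by exists N => n Nn; have := HN n Nn; rewrite /= ger0_norm ?abs_ge0.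
move=> H; apply/cvgr0Pnorm_le => e e0; have [N HN] := H _ e0.
by exists N => // n /= Nn; rewrite ger0_norm ?abs_ge0 //; exact: HN.
Qed.

Lemma abs_cvg_unique u l l' : abs_cvg abs u l -> abs_cvg abs u l' -> l = l'.
Proof.
move=> /abs_cvgP ul /abs_cvgP ul'; apply/eqP; rewrite -subr_eq0; apply/eqP.
apply: eq0_abs_le => e e0; have [N HN] := ul _ e0; have [M HM] := ul' _ e0.
have := absB_le (HM (maxn N M) (leq_maxr _ _)) (HN (maxn N M) (leq_maxl _ _)).
by rewrite opprB addrC addrA subrK.
Qed.

Definition abs_complete :=
  forall u : nat -> F, abs_cauchy abs u -> exists l, abs_cvg abs u l.

(** In an ultrametric, a distance is at most the largest of the steps in between. *)
Lemma abs_cauchy_increments u :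
  (forall e, 0 < e -> exists N, forall n, (N <= n)%N -> abs (u n.+1 - u n) <= e) ->
  abs_cauchy abs u.
Proof.
move=> H e e0; have e20 : 0 < e / 2 by rewrite divr_gt0.
have [N HN] := H _ e20; exists N.
have Hk k m : (N <= m)%N -> abs (u (m + k)%N - u m) <= e / 2.
  move=> Nm; elim: k => [|k IH]; first by rewrite addn0 subrr abs0 ltW.
  have -> : u (m + k.+1)%N - u m = (u (m + k).+1 - u (m + k)%N) + (u (m + k)%N - u m).
    by rewrite addnS addrA subrK.
  by apply: absD_le => //; apply: HN; rewrite (leq_trans Nm) ?leq_addr.
move=> m n Nm Nn; apply: (@le_lt_trans _ _ (e / 2)); last first.
  by rewrite ltr_pdivrMr // mulr_natr mulr2n ltrDl.
have -> : u m - u n = (u m - u N) - (u n - u N) by rewrite opprB addrA subrK.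
by rewrite -(subnKC Nm) -(subnKC Nn); apply: absB_le; apply: Hk.
Qed.

End AbsBasics.

(* [ball e u] stands for [||u|| <= e]; a relation is used because [normH] is a
   junk value on unbounded series. *)
Section CompleteSubspaces.
Variables (R : realType) (F : fieldType) (abs : F -> R).
Hypotheses (absP : nonarch_absval abs) (Fcomplete : abs_complete abs).
Variables (V : lmodType F) (ball : R -> V -> Prop).
Hypotheses
  (ballB : forall e u v, ball e u -> ball e v -> ball e (u - v))
  (ballZ : forall e c u, ball e u -> ball (abs c * e) (c *: u))
  (ball_le : forall e e' u, e <= e' -> ball e u -> ball e' u)
  (ball_sep : forall u, (forall e, 0 < e -> ball e u) -> u = 0).

Definition ball_cauchy (u : nat -> V) : Prop := forall e, 0 < e ->
  exists N, forall m n, (N <= m)%N -> (N <= n)%N -> ball e (u m - u n).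

Definition ball_cvg (u : nat -> V) (l : V) : Prop := forall e, 0 < e ->
  exists N, forall n, (N <= n)%N -> ball e (u n - l).

Definition ball_complete (Z : set V) : Prop := forall u,
  (forall n, Z (u n)) -> ball_cauchy u -> exists2 l, Z l & ball_cvg u l.

Lemma ball_sym e u v : ball e (u - v) -> ball e (v - u).
Proof.
by move=> uv; have := ballZ (-1) uv; rewrite (absN absP) (abs1 absP) mul1r scaleN1r opprB.
Qed.

Lemma ballD e u v : ball e u -> ball e v -> ball e (u + v).
Proof.
move=> Bu Bv; rewrite -[v]opprK; apply: ballB => //.
by have := ballZ (-1) Bv; rewrite (absN absP) (abs1 absP) mul1r scaleN1r.
Qed.

Lemma ball_cvg_cauchy u l : ball_cvg u l -> ball_cauchy u.
Proof.
move=> ul e e0; have [N HN] := ul e e0; exists N => m n Nm Nn.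
have -> : u m - u n = (u m - l) - (u n - l) by rewrite opprB addrA subrK.
by apply: ballB; apply: HN.
Qed.

(** Otherwise b would be a limit of points of Z, and uniqueness of limits would put it in Z. *)
Lemma not_near_complete Z b : ball_complete Z -> ~ Z b ->
  exists2 d, 0 < d & forall z, Z z -> ~ ball d (b - z).
Proof.
move=> Zc Zb; apply: contrapT => noD.
have near n : exists z, Z z /\ ball (n.+1%:R^-1) (b - z).
  apply: contrapT => noz; apply: noD; exists (n.+1%:R^-1); rewrite ?invr_gt0 // => z Zz Bz.
  by apply: noz; exists z.
have [z Hz] := choice near.
have zb : ball_cvg z b.
  move=> e e0; have [N Ne] := ltr_add_invr e0.
  exists N => n Nn; apply: ball_sym; apply: ball_le (Hz n).2.
  rewrite add0r in Ne; apply: le_trans (ltW Ne).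
  by rewrite lef_pV2 ?posrE // ler_nat.
have [l Zl zl] := Zc z (fun n => (Hz n).1) (ball_cvg_cauchy zb).
apply: Zb; suff -> : b = l by [].
apply/eqP; rewrite -subr_eq0; apply/eqP/ball_sep => e e0.
have [N HN] := zb e e0; have [M HM] := zl e e0.
have -> : b - l = (z (maxn N M) - l) - (z (maxn N M) - b).
  by rewrite opprB [RHS]addrC addrA subrK.
by apply: ballB; [apply/HM/leq_maxr|apply/HN/leq_maxl].
Qed.

(** If b lies at distance d > 0 from Z, then |a| d <= ||z + a b||, so the coordinate along b of a
    Cauchy sequence is Cauchy, and so is its component in Z. This one step yields both the
    completeness of finite extensions and the passage from finite codimension to the whole space. *)
Lemma complete_add_line (Z : set V) b C : Z 0 ->
  (forall c u v, Z u -> Z v -> Z (c *: u + v)) -> ball C b -> ball_complete Z ->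
  ball_complete [set v | exists2 z, Z z & exists a, v = z + a *: b].
Proof.
move=> Z0 Zlin Cb Zc; have [Zb|/(not_near_complete Zc)[d d0 far]] := pselect (Z b).
  move=> u Hu; have /Zc H : forall n, Z (u n).
    by move=> n; have [z Zz [a ->]] := Hu n; rewrite addrC; exact: Zlin.
  by move=> /H[l Zl ul]; exists l => //; exists l => //; exists 0; rewrite scale0r addr0.
move=> u Hu ucau.
have /choice[za Hza] : forall n, exists q : V * F, Z q.1 /\ u n = q.1 + q.2 *: b.
  by move=> n; have [z Zz [a ua]] := Hu n; exists (z, a).
have coefE e m n : 0 < e -> ball e (u m - u n) ->
    abs ((za m).2 - (za n).2) * d <= e.
  set a := (za m).2 - _ => e0 Bmn; rewrite leNgt; apply/negP => ead.
  have a0 : a != 0.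
    by apply: contraTneq ead => ->; rewrite (abs0 absP) mul0r -leNgt ltW.
  have [Zm um] := Hza m; have [Zn un] := Hza n.
  (* Dividing by a too large coefficient a produces a point of Z within d of b. *)
  apply: (far (a^-1 *: ((za n).1 - (za m).1))).
    have -> : (za n).1 - (za m).1 = -1 *: (za m).1 + (za n).1.
      by rewrite scaleN1r addrC.
    by rewrite -[_ *: _]addr0; apply: (Zlin) => //; exact: Zlin.
  have := ballZ a^-1 Bmn; rewrite (absV absP) um un.
  have -> : a^-1 *: ((za m).1 + (za m).2 *: b - ((za n).1 + (za n).2 *: b)) =
      b - a^-1 *: ((za n).1 - (za m).1).
    rewrite opprD addrACA -scalerBl -/a scalerDr scalerA mulVf // scale1r [LHS]addrC.
    by rewrite -scalerN opprB.
  apply: ball_le; rewrite mulrC ler_pdivrMr ?(abs_gt0 absP) //.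
  by rewrite mulrC ltW.
have acau : abs_cauchy abs (fun n => (za n).2).
  move=> e e0; have ed0 : 0 < e / 2 * d by rewrite mulr_gt0 ?divr_gt0.
  have [N HN] := ucau _ ed0; exists N => m n Nm Nn.
  apply: (@le_lt_trans _ _ (e / 2)); last by rewrite ltr_pdivrMr // mulr_natr mulr2n ltrDl.
  by rewrite -(ler_pM2r d0); apply: coefE => //; exact: HN.
have [a /(abs_cvgP absP) aa] := Fcomplete acau.
have ab : ball_cvg (fun n => (za n).2 *: b) (a *: b).
  move=> e e0; have M0 : 0 < Num.max C 1 by rewrite lt_max ltr01 orbT.
  have [N HN] := aa _ (divr_gt0 e0 M0); exists N => n Nn.
  have Mb : ball (Num.max C 1) b by apply: ball_le Cb; rewrite le_max lexx.
  rewrite -scalerBl; apply: ball_le (ballZ _ Mb).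
  by rewrite -ler_pdivlMr //; exact: HN.
have zE n : (za n).1 = u n - (za n).2 *: b by rewrite (Hza n).2 addrK.
have zcau : ball_cauchy (fun n => (za n).1).
  move=> e e0; have [N HN] := ucau e e0.
  have [M HM] := ball_cvg_cauchy ab e0; exists (maxn N M) => m n.
  rewrite !geq_max => /andP[Nm Mm] /andP[Nn Mn].
  have -> : (za m).1 - (za n).1 =
      (u m - u n) - ((za m).2 *: b - (za n).2 *: b).
    by rewrite !zE [in LHS]opprD addrACA -opprD.
  by apply: ballB; [exact: HN|exact: HM].
have [z Zz zz] := Zc _ (fun n => (Hza n).1) zcau.
exists (z + a *: b); first by exists z => //; exists a.
move=> e e0; have [N HN] := zz e e0; have [M HM] := ab e e0.
exists (maxn N M) => n; rewrite geq_max => /andP[Nn Mn].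
by rewrite (Hza n).2 opprD addrACA; apply: ballD; [exact: HN|exact: HM].
Qed.

End CompleteSubspaces.

(** * Fermat's congruence in Z_p, and completeness of finite extensions of Q_p *)

Section Padic.
Variables (R : realType) (p : nat) (Qp : fieldType) (absQ : Qp -> R).
Hypotheses (p_prime : prime p) (QpP : padic_completion p absQ).
Let absQP := padic_absval QpP.

Lemma padic_abs_nat n : (0 < n)%N -> absQ n%:R = (p%:R ^+ logn p n)^-1.
Proof.
move=> n0; have -> : n%:R = ratr n%:R :> Qp.
  by rewrite -[in RHS]mulrz_nat ratr_int mulrz_nat.
rewrite (padic_ratr QpP) /padic_abs_rat pnatr_eq0 gtn_eqF //.
by rewrite -[n%:R]mulrz_nat numq_int denq_int /= natz logn1 sub0r -invr_expz -exprnP.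
Qed.

Lemma padic_abs_p : absQ p%:R = p%:R^-1.
Proof. by rewrite padic_abs_nat ?prime_gt0 // logn_prime // eqxx expr1. Qed.

Lemma padic_abs_unit n : (0 < n)%N -> ~~ (p %| n)%N -> absQ n%:R = 1.
Proof.
by move=> n0 pn; rewrite padic_abs_nat // lognE p_prime n0 (negPf pn) expr0 invr1.
Qed.

Lemma padic_nat_neq0 n : (0 < n)%N -> n%:R != 0 :> Qp.
Proof.
move=> n0; apply/eqP => /(absval_eq0 absQP)/eqP; rewrite padic_abs_nat //.
by rewrite invr_eq0 expf_eq0 pnatr_eq0 (gtn_eqF (prime_gt0 p_prime)) andbF.
Qed.

Lemma padic_abs_dvd n : (p %| n)%N -> absQ n%:R <= p%:R^-1.
Proof.
move=> /dvdnP[m ->]; rewrite natrM (absM absQP) padic_abs_p.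
by rewrite ler_piMl ?invr_ge0 // abs_nat_le1.
Qed.

Lemma absB_exp_le x y n e : absQ x <= 1 -> absQ y <= 1 -> absQ (x - y) <= e ->
  absQ (x ^+ n - y ^+ n) <= e.
Proof.
move=> x1 y1 xye; rewrite subrXX (absM absQP) -[e]mulr1.
apply: ler_pM => //; rewrite ?(abs_ge0 absQP) //.
apply: (abs_sum_le absQP) => // i _; rewrite (absM absQP) !(absX absQP).
by rewrite -[1]mulr1; apply: ler_pM; rewrite ?exprn_ge0 ?exprn_ile1 ?(abs_ge0 absQP).
Qed.

Lemma padic_fermat_nat n : absQ (n%:R ^+ p - n%:R) <= p%:R^-1.
Proof.
have np : (n <= n ^ p)%N.
  case: n => // n; rewrite -[leqLHS]expn1; apply: leq_pexp2l => //.
  exact: prime_gt0.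
rewrite -natrX -natrB //; apply: padic_abs_dvd.
by rewrite -eqn_mod_dvd //; apply/eqP/fermat_little.
Qed.

Lemma padic_fermat_int (n : int) : absQ (n%:~R ^+ p - n%:~R) <= p%:R^-1.
Proof.
case: n => n; first exact: padic_fermat_nat.
rewrite NegzE mulrNz; set m : Qp := _%:~R.
have mp : absQ (m ^+ p - m) <= p%:R^-1 by exact: padic_fermat_nat.
(* For odd p the sign passes through the power; for p = 2 it costs 2m, which is divisible by p. *)
have [p2|p_odd] := even_prime p_prime.
  have -> : (- m) ^+ p - - m = (m ^+ p - m) + p%:R * m.
    by rewrite p2 sqrrN opprK mulr_natl mulr2n addrA subrK.
  apply: (absD_le absQP) => //; rewrite (absM absQP) padic_abs_p.
  by rewrite ler_piMr ?invr_ge0 // (abs_int_le1 absQP).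
by rewrite exprNn -signr_odd p_odd expr1 mulN1r opprK addrC -opprB (absN absQP).
Qed.

(* Rationals are dense, so it suffices to reduce numerator and denominator mod p. *)
Lemma padic_fermat x : absQ x <= 1 -> absQ (x ^+ p - x) <= p%:R^-1.
Proof.
move=> x1; have p0 : 0 < p%:R^-1 :> R by rewrite invr_gt0 ltr0n prime_gt0.
have p1 : p%:R^-1 <= 1 :> R by rewrite invf_le1 ?ltr0n ?ler1n prime_gt0.
have [q /ltW xq] := padic_dense QpP x p0.
have q1 : absQ (ratr q) <= 1.
  rewrite -[ratr q](subKr x); apply: (absB_le absQP) => //.
  exact: le_trans xq p1.
suff qp : absQ (ratr q ^+ p - ratr q) <= p%:R^-1.
  have -> : x ^+ p - x = (x ^+ p - ratr q ^+ p) + (ratr q ^+ p - ratr q) - (x - ratr q).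
    by rewrite addrA subrK opprB addrA subrK.
  by apply: (absB_le absQP) => //; apply: (absD_le absQP) => //; apply: absB_exp_le.
have [->|q0] := eqVneq q 0.
  have -> : ratr 0 = 0 :> Qp by exact: (ratr_int _ 0).
  rewrite expr0n gtn_eqF ?prime_gt0 // subr0 (abs0 absQP).
  exact: ltW.
have pden : ~~ (p %| `|denq q|)%N.
  apply/negP => pd; move: q1; rewrite (padic_ratr QpP) /padic_abs_rat (negPf q0).
  have pn : ~~ (p %| `|numq q|)%N.
    apply/negP => pn; have := coprime_num_den q.
    by move/eqP => cop; have := dvdn_gcd p `|numq q| `|denq q|;
      rewrite cop pn pd dvdn1 => /eqP p1E; move: p_prime; rewrite p1E.
  rewrite [X in _ - X%:Z]lognE p_prime absz_gt0 numq_eq0 q0 (negPf pn) subr0.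
  rewrite -exprnP leNgt; apply/negP/negPn.
  rewrite exprn_egt1 ?ltr1n ?prime_gt1 //.
  by rewrite -lt0n logn_gt0 mem_primes p_prime absz_gt0 denq_neq0.
have bE : absQ (denq q)%:~R = 1.
  rewrite -(gez0_abs (denq_ge0 q)) padic_abs_unit //.
  by rewrite absz_gt0 denq_neq0.
set a : Qp := (numq q)%:~R; set b : Qp := (denq q)%:~R.
have b0 : b != 0 by apply/eqP => /(absval_eq0 absQP)/eqP; rewrite bE oner_eq0.
have -> : ratr q = a / b by [].
have -> : (a / b) ^+ p - a / b = b^-1 ^+ p.+1 * (b * (a ^+ p - a) - a * (b ^+ p - b)).
  rewrite exprMn exprS !exprVn; have := expf_neq0 p b0.
  by move: (b ^+ p) (a ^+ p) => b' a' b'0; field; rewrite b0 b'0.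
rewrite (absM absQP) (absX absQP) (absV absQP) bE invr1 expr1n mul1r.
apply: (absB_le absQP); rewrite (absM absQP) -[X in _ <= X]mul1r.
  by rewrite bE !mul1r padic_fermat_int.
by apply: ler_pM; rewrite ?(abs_ge0 absQP) ?(abs_int_le1 absQP) ?padic_fermat_int.
Qed.

Variables (K : fieldExtType Qp) (abs : K -> R).
Hypothesis absP : absval_extension absQ abs.
Let absKP := ext_absval absP.

Lemma ext_absZ c x : abs (c *: x) = absQ c * abs x.
Proof. by rewrite -(ext_restr absP) -(absM absKP) mulr_algl. Qed.

Lemma ext_abs_nat n : abs n%:R = absQ n%:R.
Proof. by rewrite -(ext_restr absP) scaler_nat. Qed.

(** The spans of the initial pieces of a basis are complete by induction, one line being added at a
    time; no equivalence of norms is used. *)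
Lemma ext_complete : abs_complete abs.
Proof.
pose ball (e : R) (u : K) := abs u <= e.
have H (s : seq K) : ball_complete ball [set x | x \in <<s>>%VS].
  elim: s => [|b s IH].
    move=> u Hu _; exists 0; first by rewrite /= mem0v.
    move=> e e0; exists 0%N => n _; have := Hu n.
    rewrite /= span_nil memv0 => /eqP ->.
    by rewrite /ball subrr (abs0 absKP) ltW.
  have -> : [set x | x \in <<b :: s>>%VS] =
      [set v | exists2 z, [set x | x \in <<s>>%VS] z & exists a, v = z + a *: b].
    apply/seteqP; split => x /=; rewrite span_cons.
      move=> /memv_addP[y /vlineP[a ->] [z zs ->]]; exists z => //; exists a.
      by rewrite addrC.
    move=> [z zs [a ->]]; rewrite addrC; apply: memv_add => //.
    by apply/vlineP; exists a.
  apply: (complete_add_line absQP (padic_complete QpP) _ _ _ _ _ _ (C := abs b)).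
  - by move=> e u v; exact: (absB_le absKP).
  - by move=> e c u; rewrite /ball ext_absZ => ?; rewrite ler_wpM2l ?(abs_ge0 absQP).
  - by move=> e e' u ee' ue; exact: le_trans ee'.
  - exact: (eq0_abs_le absKP).
  - by rewrite /= mem0v.
  - by move=> c u v /= us vs; rewrite memvD ?memvZ.
  - exact: lexx.
  - exact: IH.
move=> u ucau.
have [n|e e0|l _ ul] := H (vbasis (@fullv _ K)) u.
- by rewrite /= (span_basis (vbasisP _)) memvf.
- have [N HN] := ucau e e0; exists N => m n Nm Nn.
  by rewrite /ball ltW // HN.
- by exists l; apply/(abs_cvgP absKP).
Qed.

End Padic.

(** * Formal exponentials and the Artin-Hasse series *)

Section PowerSeriesTheory.
Variable F : fieldType.
Implicit Types f g a b : nat -> F.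

(** Coefficients up to n depend only on truncations, so identities between series are inherited from
    the polynomial ring. *)
Definition ps_trunc n f : {poly F} := \poly_(i < n.+1) f i.

Lemma coef_ps_trunc n f i : (i <= n)%N -> f i = (ps_trunc n f)`_i.
Proof. by move=> ni; rewrite coef_poly ltnS ni. Qed.

Lemma ps_mul_coef n f g (P Q : {poly F}) :
  (forall i, (i <= n)%N -> f i = P`_i) -> (forall i, (i <= n)%N -> g i = Q`_i) ->
  forall i, (i <= n)%N -> ps_mul f g i = (P * Q)`_i.
Proof.
move=> fP gQ i ni; rewrite coefM /ps_mul; apply: eq_bigr => j _.
by rewrite fP ?gQ // (leq_trans _ ni) ?leq_subr // -ltnS.
Qed.

Lemma ps_mulE n f g i : (i <= n)%N ->
  ps_mul f g i = (ps_trunc n f * ps_trunc n g)`_i.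
Proof. by apply: ps_mul_coef => j; exact: coef_ps_trunc. Qed.

Lemma ps_mulC : commutative (@ps_mul F).
Proof. by move=> f g; apply/funext => n; rewrite !(@ps_mulE n) // mulrC. Qed.

Lemma ps_mulA : associative (@ps_mul F).
Proof.
move=> f g h; apply/funext => n.
have T f := @coef_ps_trunc n f; have M f g := @ps_mulE n f g.
rewrite (ps_mul_coef (T f) (M g h)) // mulrA.
by rewrite (ps_mul_coef (M f g) (T h)).
Qed.

Lemma ps_mul1 : left_id (@ps_one F) (@ps_mul F).
Proof.
move=> f; apply/funext => n; rewrite /ps_mul big_ord_recl /ps_one mul1r subn0.
by rewrite big1 ?addr0 // => i _; rewrite mul0r.
Qed.

HB.instance Definition _ :=
  Monoid.isComLaw.Build (nat -> F) (@ps_one F) (@ps_mul F) ps_mulA ps_mulC ps_mul1.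

Lemma ps_mulDl : left_distributive (@ps_mul F) (fun f g n => f n + g n).
Proof.
move=> f g h; apply/funext => n; rewrite /ps_mul -big_split.
by apply: eq_bigr => i _; rewrite mulrDl.
Qed.

Lemma iter_ps_mul_coef n f (P : {poly F}) k :
  (forall i, (i <= n)%N -> f i = P`_i) ->
  forall i, (i <= n)%N -> iter k (ps_mul f) (@ps_one F) i = (P ^+ k)`_i.
Proof.
move=> fP; elim: k => [|k IH] i ni; first by rewrite expr0 coef1.
by rewrite iterS exprS; exact: (ps_mul_coef fP).
Qed.

Lemma ps_mul_inflate m f g : (0 < m)%N ->
  ps_mul (ps_inflate m f) (ps_inflate m g) = ps_inflate m (ps_mul f g).
Proof.
move=> m0; apply/funext => n.
have I h i : (i <= n)%N -> ps_inflate m h i = (ps_trunc n h \Po 'X^m)`_i.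
  move=> ni; rewrite coef_comp_poly_Xn // /ps_inflate; case: ifP => // _.
  by rewrite -coef_ps_trunc // (leq_trans _ ni) // leq_div.
rewrite (ps_mul_coef (I f) (I g)) // -comp_polyM coef_comp_poly_Xn // /ps_inflate.
by case: ifP => // _; rewrite (@ps_mulE n) // leq_div.
Qed.

(* T d/dT *)
Definition ps_theta f : nat -> F := fun n => n%:R * f n.

Lemma ps_theta_mul f g : ps_theta (ps_mul f g) =
  fun n => ps_mul (ps_theta f) g n + ps_mul f (ps_theta g) n.
Proof.
apply/funext => n; rewrite /ps_theta /ps_mul -big_split mulr_sumr.
apply: eq_bigr => i _ /=; have ni : (i <= n)%N by rewrite -ltnS.
by rewrite -{1}(subnKC ni) natrD; ring.
Qed.

(* The differential equation that characterizes a = exp f when f 0 = 0. *)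
Definition is_exp f a : Prop := a 0%N = 1 /\ ps_theta a = ps_mul (ps_theta f) a.

Hypothesis char0 : forall n, n.+1%:R != 0 :> F.

(** As [ps_theta f] has no constant term, the equation expresses (i + 1) a_(i+1) through a_0, ...,
    a_i, and i + 1 is invertible. *)
Lemma is_exp_unique n f g a b : (forall i, (i <= n)%N -> f i = g i) ->
  is_exp f a -> is_exp g b -> forall i, (i <= n)%N -> a i = b i.
Proof.
move=> fg [a0 fa] [b0 gb]; elim/ltn_ind => -[|i] IH ni; first by rewrite a0 b0.
apply: (mulfI (char0 i)).
have := congr1 (@^~ i.+1) fa; have := congr1 (@^~ i.+1) gb.
rewrite /= /ps_theta => -> ->; apply: eq_bigr => -[[|j] /= ji] _.
  by rewrite !mul0r.
by rewrite fg ?IH //; lia.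
Qed.

Lemma is_exp0 : is_exp (fun=> 0) (@ps_one F).
Proof.
split => //; apply/funext => -[|n]; rewrite /ps_theta /ps_mul big1 ?mul0r ?mulr0 //.
  by move=> i _; rewrite mulr0 mul0r.
by move=> i _; rewrite mulr0 mul0r.
Qed.

Lemma is_expD f g a b : is_exp f a -> is_exp g b ->
  is_exp (fun n => f n + g n) (ps_mul a b).
Proof.
move=> [a0 fa] [b0 gb]; split; first by rewrite /ps_mul big_ord1 a0 b0 mulr1.
have -> : ps_theta (fun n => f n + g n) = fun n => ps_theta f n + ps_theta g n.
  by apply/funext => n; rewrite /ps_theta mulrDr.
rewrite ps_theta_mul ps_mulDl fa gb; apply/funext => n.
by congr (_ + _); rewrite !ps_mulA // [ps_mul a _]ps_mulC.
Qed.

Lemma is_exp_iter f a k : is_exp f a ->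
  is_exp (fun n => k%:R * f n) (iter k (ps_mul a) (@ps_one F)).
Proof.
move=> fa; elim: k => [|k IH].
  by rewrite (_ : (fun n => _) = fun=> 0); [exact: is_exp0|apply/funext => n; rewrite mul0r].
rewrite iterS (_ : (fun n => _) = fun n => f n + k%:R * f n); last first.
  by apply/funext => n; rewrite -natr1 mulrDl mul1r addrC.
exact: is_expD.
Qed.

Lemma is_exp_inflate m f a : (0 < m)%N -> is_exp f a ->
  is_exp (ps_inflate m f) (ps_inflate m a).
Proof.
move=> m0 [a0 fa]; split; first by rewrite /ps_inflate dvdn0 div0n.
have thetaI h : ps_theta (ps_inflate m h) = fun n => m%:R * ps_inflate m (ps_theta h) n.
  apply/funext => n; rewrite /ps_theta /ps_inflate; case: ifP => [/dvdnP[q ->]|_].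
    by rewrite mulnK // natrM mulrCA mulrA.
  by rewrite !mulr0.
rewrite !thetaI fa -ps_mul_inflate //; apply/funext => n.
by rewrite /ps_mul mulr_sumr; apply: eq_bigr => i _; rewrite mulrA.
Qed.

Lemma is_exp_dilate c f a : is_exp f a -> is_exp (ps_dilate c f) (ps_dilate c a).
Proof.
move=> [a0 fa]; split; first by rewrite /ps_dilate expr0 mul1r.
apply/funext => n; have := congr1 (@^~ n) fa.
rewrite /= /ps_theta /ps_dilate mulrCA => ->; rewrite /ps_mul mulr_sumr.
apply: eq_bigr => i _; have ni : (i <= n)%N by rewrite -ltnS.
by rewrite -{1}(subnKC ni) exprD; ring.
Qed.

Lemma is_exp_linear c :
  is_exp (fun n => c * (n == 1%N)%:R) (fun n => c ^+ n / n`!%:R).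
Proof.
split; first by rewrite expr0 fact0 divr1.
apply/funext => -[|n]; rewrite /ps_theta /ps_mul.
  by rewrite big_ord1 !mul0r.
rewrite 2!big_ord_recl big1 => [|i _]; last by rewrite !mulr0 mul0r.
rewrite !mul0r add0r addr0 /= mulr1 mul1r subSS subn0 factS natrM exprS.
rewrite invfM; have := char0 n; have := expf_neq0; move: (n.+1%:R) => x _ x0.
by rewrite [x^-1 * _]mulrC !mulrA mulrC !mulrA mulVf // mul1r.
Qed.

Lemma is_expP f : f 0%N = 0 -> is_exp f (ps_exp f).
Proof.
move=> f0; split.
  by rewrite /ps_exp big_ord1 /= fact0 invr1 mul1r /ps_one eqxx.
apply/funext => -[|n]; first by rewrite /ps_theta /ps_mul big_ord1 !mul0r.
set P := ps_trunc n.+1 f.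
have fP i : (i <= n.+1)%N -> f i = P`_i := @coef_ps_trunc _ _ i.
have low k m : (m < k)%N -> (P ^+ k)`_m = 0.
  elim: k m => // k IH m mk; rewrite exprS coefM big1 // => -[[|j] /= jm] _.
    by rewrite -fP // f0 mul0r.
  by rewrite IH ?mulr0 //; lia.
pose Q := \sum_(k < n.+2) (k`!%:R)^-1 *: P ^+ k.
have QE m : (m <= n.+1)%N -> ps_exp f m = Q`_m.
  move=> mn; rewrite coef_sum /ps_exp.
  rewrite (big_ord_widen n.+2 (fun k => (k`!%:R)^-1 * iter k (ps_mul f) (@ps_one F) m)) //.
  rewrite [LHS]big_mkcond; apply: eq_bigr => k _; rewrite coefZ ltnS.
  by case: leqP => mk; rewrite ?(iter_ps_mul_coef _ fP) // low // mulr0.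
(* Differentiation loses the last term of the truncated exponential; P^(n+1) starts in degree n + 1,
   so the coefficient of degree n does not see the difference. *)
have QD : Q^`() = P^`() * (Q - ((n.+1)`!%:R)^-1 *: P ^+ n.+1).
  rewrite /Q [in RHS]big_ord_recr /= addrK big_ord_recl raddfD /= expr0.
  rewrite linearZ /= derivC scaler0 add0r raddf_sum mulr_sumr.
  apply: eq_bigr => k _; rewrite /= derivZ deriv_exp -scaler_nat scalerA -scalerAr.
  congr (_ *: _); rewrite factS natrM invfM mulrC mulrA mulfV ?mul1r //.
have := congr1 (fun A : {poly F} => A`_n) QD.
rewrite coef_deriv -QE // => E.
rewrite /ps_theta mulr_natl {}E coefM /ps_mul [in RHS]big_ord_recl !mul0r add0r.
apply: eq_bigr => i _; have ni : (i <= n)%N by rewrite -ltnS.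
rewrite coef_deriv -fP // [nat_of_ord (lift _ _)]lift0 subSS.
by rewrite coefB coefZ low ?mulr0 ?subr0 ?QE ?mulr_natl //; lia.
Qed.

Lemma ps_exp_dilate c f : f 0%N = 0 -> ps_exp (ps_dilate c f) = ps_dilate c (ps_exp f).
Proof.
move=> f0; apply/funext => n.
apply: (@is_exp_unique n (ps_dilate c f) (ps_dilate c f)) => //.
  by apply: is_expP; rewrite /ps_dilate f0 mulr0.
exact/is_exp_dilate/is_expP.
Qed.

End PowerSeriesTheory.

(** * Gauss norm of polynomials and the Frobenius congruence modulo p *)

Section GaussBound.
Variables (R : realType) (F : fieldType) (abs : F -> R).
Hypothesis absP : nonarch_absval abs.
Implicit Types P Q : {poly F}.

Definition gauss_le (e : R) P : Prop := forall i, abs P`_i <= e.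

Lemma gauss_leD e P Q : gauss_le e P -> gauss_le e Q -> gauss_le e (P + Q).
Proof. by move=> Pe Qe i; rewrite coefD; exact: (absD_le absP). Qed.

Lemma gauss_leM e e' P Q : 0 <= e -> 0 <= e' ->
  gauss_le e P -> gauss_le e' Q -> gauss_le (e * e') (P * Q).
Proof.
move=> e0 e'0 Pe Qe i; rewrite coefM; apply: (abs_sum_le absP); first exact: mulr_ge0.
by move=> j _; rewrite (absM absP); apply: ler_pM; rewrite ?(abs_ge0 absP).
Qed.

Lemma gauss_leX P k : gauss_le 1 P -> gauss_le 1 (P ^+ k).
Proof.
move=> P1; elim: k => [|k IH].
  move=> i; rewrite expr0 coef1; case: (i == 0%N); first by rewrite (abs1 absP).
  by rewrite (abs0 absP).
by rewrite exprS -[1]mulr1; exact: gauss_leM.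
Qed.

Lemma gauss_le_sum e n (P : 'I_n -> {poly F}) : 0 <= e ->
  (forall i, gauss_le e (P i)) -> gauss_le e (\sum_i P i).
Proof. by move=> e0 Pe i; rewrite coef_sum; apply: (abs_sum_le absP) => // j _; exact: Pe. Qed.

Lemma gauss_le_monom c n : abs c <= 1 -> gauss_le 1 (c *: 'X^n).
Proof.
move=> c1 i; rewrite coefZ coefXn (absM absP); case: (i == n).
  by rewrite (abs1 absP) mulr1.
by rewrite (abs0 absP) mulr0.
Qed.

Variable p : nat.
Hypotheses (p_prime : prime p) (abs_p : forall n, (p %| n)%N -> abs n%:R <= p%:R^-1).

Let ip0 : 0 <= p%:R^-1 :> R. Proof. by rewrite invr_ge0. Qed.

Lemma gauss_le_freshman P Q : gauss_le 1 P -> gauss_le 1 Q ->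
  gauss_le p%:R^-1 ((P + Q) ^+ p - (P ^+ p + Q ^+ p)).
Proof.
move=> P1 Q1; have := prime_gt0 p_prime; case: p p_prime abs_p ip0 => // q q_prime abs_q iq0 _.
rewrite exprDn big_ord_recl big_ord_recr /= /bump /= add1n.
rewrite subn0 expr0 mulr1 bin0 mulr1n subnn mul1r binn mulr1n opprD.
rewrite addrACA subrr add0r addrK; apply: gauss_le_sum => // i k.
rewrite add1n coefMn -[_`_k *+ _]mulr_natl (absM absP) -[X in _ <= X]mulr1.
apply: ler_pM; rewrite ?(abs_ge0 absP) //.
  by apply: abs_q; apply: prime_dvd_bin => //=; rewrite ltnS ltn_ord.
by have := gauss_leM ler01 ler01 (@gauss_leX _ (q.+1 - i.+1) P1) (@gauss_leX _ i.+1 Q1) k;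
  rewrite mulr1.
Qed.

Lemma gauss_le_frobenius n (c : nat -> F) : (forall i, (i < n)%N -> abs (c i) <= 1) ->
  gauss_le p%:R^-1 ((\sum_(i < n) c i *: 'X^i) ^+ p - \sum_(i < n) c i ^+ p *: 'X^(i * p)).
Proof.
elim: n => [|n IH] c1.
  rewrite !big_ord0 expr0n gtn_eqF ?prime_gt0 // subr0 => i.
  by rewrite coef0 (abs0 absP).
rewrite !big_ord_recr /=; set S := \sum_(i < n) _ *: 'X^i; set T := \sum_(i < n) _.
have -> : (S + c n *: 'X^n) ^+ p - (T + c n ^+ p *: 'X^(n * p)) =
   ((S + c n *: 'X^n) ^+ p - (S ^+ p + (c n *: 'X^n) ^+ p)) + (S ^+ p - T).
  by rewrite exprZn -exprM; ring.
apply: gauss_leD; last by apply: IH => i ni; apply: c1; exact: ltnW.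
apply: gauss_le_freshman; last exact/gauss_le_monom/c1.
by apply: gauss_le_sum => // i; apply/gauss_le_monom/c1/ltnW/ltn_ord.
Qed.

End GaussBound.

(** * Integrality of the Artin-Hasse exponential *)

Section ArtinHasse.

Lemma ps_l_pow (F : fieldType) p k : prime p -> ps_l F p (p ^ k)%N = p%:R^-1 ^+ k.
Proof.
move=> /prime_gt1 p1; rewrite /ps_l.
have kp : (k < (p ^ k).+1)%N by rewrite ltnS ltnW // ltn_expl.
rewrite (bigD1 (Ordinal kp)) //= big1 ?addr0 // => i /andP[/eqP pi /eqP ni].
by case: ni; apply/val_inj/eqP; rewrite /= -(eqn_exp2l _ _ p1) pi.
Qed.

Lemma ps_l_notpow (F : fieldType) p n : (forall k, (p ^ k)%N != n) -> ps_l F p n = 0.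
Proof. by move=> np; rewrite /ps_l big1 // => i; rewrite (negPf (np i)). Qed.

Lemma ps_l_small (F : fieldType) p n : prime p -> (n < p)%N ->
  ps_l F p n = (n == 1%N)%:R.
Proof.
move=> p_prime np; case: eqVneq => [->|n1].
  by rewrite -(expn0 p) ps_l_pow // expr0.
rewrite ps_l_notpow // => -[|k]; first by rewrite expn0 eq_sym.
rewrite gtn_eqF // (leq_trans np) // expnS leq_pmulr // expn_gt0.
by rewrite prime_gt0.
Qed.

Lemma ps_l0 (F : fieldType) p : prime p -> ps_l F p 0%N = 0.
Proof. by move=> p_prime; rewrite ps_l_small ?prime_gt0. Qed.

(* p l(T) = l(T^p) + p T *)
Lemma ps_l_functional (F : fieldType) p n : prime p -> p%:R != 0 :> F ->
  p%:R * ps_l F p n = ps_inflate p (ps_l F p) n + p%:R * (n == 1%N)%:R.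
Proof.
move=> p_prime p0; have p1 := prime_gt1 p_prime; rewrite /ps_inflate.
have [[k kn]|np] := pselect (exists k, (p ^ k)%N = n).
  rewrite -kn ps_l_pow //; case: k kn => [|k] kn.
    by rewrite expn0 dvdn1 gtn_eqF // add0r.
  rewrite expnS dvdn_mulr // mulKn ?prime_gt0 // ps_l_pow // exprS mulrA mulfV //.
  rewrite mul1r gtn_eqF ?mulr0 ?addr0 // -expnS -[X in (X < _)%N](expn0 p).
  by rewrite ltn_exp2l.
rewrite ps_l_notpow; last by move=> k; apply/eqP => kn; apply: np; exists k.
rewrite mulr0; case: eqVneq => [n1|_].
  by case: np; exists 0%N; rewrite n1.
rewrite mulr0 addr0; case: ifP => // /dvdnP[m nE].
rewrite ps_l_notpow // => k; apply/eqP => km; apply: np; exists k.+1.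
by rewrite expnSr km nE mulnK ?prime_gt0.
Qed.

(** Legendre's sum for n is n/p (rounded down) plus the same sum for n/p, which is below n/p by
    induction, while 2(n/p) <= n. *)
Lemma logn_fact_lt p n : prime p -> (0 < n)%N -> (logn p n`! < n)%N.
Proof.
move=> p_prime; rewrite logn_fact //; move: n.+1 => K; elim: K n => [|K IH] n n0.
  by rewrite big_geq.
case: K IH => [|K] IH; first by rewrite big_geq.
rewrite big_nat_recl // expn1.
under eq_bigr => i _ do rewrite expnS divnMA.
have p2 := prime_gt1 p_prime.
have [->|q0] := posnP (n %/ p).
  by rewrite big1 // => i _; rewrite div0n.
have := IH _ q0; have : ((n %/ p) * 2 <= n)%N.
  by apply: leq_trans (leq_trunc_div n p); rewrite leq_mul2l p2 orbT.
lia.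
Qed.

Variables (R : realType) (p : nat) (Qp : fieldType) (absQ : Qp -> R).
Hypotheses (p_prime : prime p) (QpP : padic_completion p absQ).
Let absQP := padic_absval QpP.

Let char0 n : n.+1%:R != 0 :> Qp.
Proof. exact: padic_nat_neq0 p_prime QpP _ _. Qed.

Let p0 : p%:R != 0 :> Qp.
Proof. by apply: (padic_nat_neq0 p_prime QpP); exact: prime_gt0. Qed.

(** This makes exp(pT) congruent to 1 modulo p. *)
Lemma padic_abs_exp_p j : (0 < j)%N -> absQ (p%:R ^+ j / j`!%:R) <= p%:R^-1.
Proof.
move=> j0; rewrite (absM absQP) (absX absQP) (absV absQP) (padic_abs_p p_prime QpP).
rewrite (padic_abs_nat QpP) ?fact_gt0 // invrK.
have := logn_fact_lt p_prime j0; set L := logn p j`! => jl.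
have pR : p%:R != 0 :> R by rewrite pnatr_eq0 gtn_eqF // prime_gt0.
rewrite -(subnKC jl); move: (j - _)%N => k; rewrite addSn exprS exprD -mulrA -[X in _ <= X]mulr1.
rewrite ler_pM2l ?invr_gt0 ?ltr0n ?prime_gt0 //.
rewrite mulrAC -exprMn mulVf // expr1n mul1r exprn_ile1 ?invr_ge0 //.
by rewrite invf_le1 ?ltr0n ?ler1n prime_gt0.
Qed.

Let E := ps_exp (ps_l Qp p).

(* Dwork: E(T)^p = E(T^p) exp(p T) *)
Lemma artin_hasse_functional n :
  iter p (ps_mul E) (@ps_one Qp) n =
  ps_mul (ps_inflate p E) (fun n => p%:R ^+ n / n`!%:R) n.
Proof.
have Eexp : is_exp (ps_l Qp p) E by apply: is_expP => //; exact: ps_l0.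
apply: (@is_exp_unique _ char0 n (fun n => p%:R * ps_l Qp p n)
  (fun n => ps_inflate p (ps_l Qp p) n + p%:R * (n == 1%N)%:R)) => //.
- by move=> i _; exact: ps_l_functional.
- exact: is_exp_iter.
- apply: is_expD; last exact: is_exp_linear.
  by apply: is_exp_inflate => //; exact: prime_gt0.
Qed.

(** Let S be the part of E of degree below n, and u the coefficient of T^n in E(T^p). In Dwork's
    equation the left side has coefficient (S^p)_n + p E_n, where (S^p)_n = u^p modulo p by
    Frobenius; the right side has u modulo p, by the induction hypothesis and exp(pT) = 1 modulo p.
    As u^p = u modulo p by Fermat, |p E_n| <= 1/p. *)
Lemma artin_hasse_integral n : absQ (E n) <= 1.
Proof.
have ip0 : 0 < p%:R^-1 :> R by rewrite invr_gt0 ltr0n prime_gt0.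
have E0 : E 0%N = 1 by rewrite /E /ps_exp big_ord1 /= fact0 invr1 mul1r.
elim/ltn_ind: n => -[|m] IH; first by rewrite E0 (abs1 absQP).
set n := m.+1 in IH *.
have nSp : (n %/ p < n)%N by rewrite ltn_Pdiv ?prime_gt1.
pose S := \sum_(i < n) E i *: 'X^i.
have trS : ps_trunc n E = S + E n *: 'X^n.
  by rewrite /ps_trunc poly_def big_ord_recr.
have S0 : S`_0 = 1.
  rewrite /S big_ord_recl coefD coefZ coefXn E0 mulr1 coef_sum big1 ?addr0 // => i _.
  by rewrite coefZ coefXn mulr0.
(* First-order expansion: since S has constant term 1, (S + E_n T^n)^k = S^k + k E_n T^n modulo
   T^(n+1). *)
have powS k : exists2 G : {poly Qp}, (S + E n *: 'X^n) ^+ k = S ^+ k + 'X^n * G &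
    G`_0 = k%:R * E n.
  elim: k => [|k [G GE G0]]; first by exists 0; rewrite ?mulr0 ?addr0 ?coef0 ?mul0r.
  exists (S * G + E n *: S ^+ k + E n *: ('X^n * G)).
    by rewrite exprS GE exprS -!mul_polyC; ring.
  have S0k : (S ^+ k)`_0 = 1 by rewrite -horner_coef0 horner_exp horner_coef0 S0 expr1n.
  rewrite !coefD !coefZ -!horner_coef0 hornerM !horner_coef0 coefXnM /= mulr0 addr0.
  by rewrite S0k S0 G0 -natr1; ring.
have [G GE G0] := powS p.
have := artin_hasse_functional n.
rewrite (iter_ps_mul_coef p (@coef_ps_trunc _ n E)) // trS GE coefD coefXnM ltnn subnn G0.
pose u := ps_inflate p E n.
rewrite /ps_mul big_ord_recr /= subnn expr0 fact0 divr1 mulr1 -/u.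
set rest := \sum_(i < n) _ => key.
have restle : absQ rest <= p%:R^-1.
  apply: (abs_sum_le absQP); first exact: ltW.
  move=> i _; rewrite (absM absQP) -[X in _ <= X]mul1r.
  apply: ler_pM; rewrite ?(abs_ge0 absQP) //.
    rewrite /ps_inflate; case: ifP => _; last by rewrite (abs0 absQP).
    by apply: IH; apply: leq_ltn_trans (leq_div _ _) (ltn_ord i).
  by apply: padic_abs_exp_p; rewrite subn_gt0.
have u1 : absQ u <= 1.
  rewrite /u /ps_inflate; case: ifP => _; last by rewrite (abs0 absQP).
  exact: IH.
have SpE : (\sum_(i < n) E i ^+ p *: 'X^(i * p) : {poly Qp})`_n = u ^+ p.
  rewrite coef_sum /u /ps_inflate; case: ifP => [pn|pn].
    rewrite (bigD1 (Ordinal nSp)) //= coefZ coefXn divnK // eqxx mulr1 big1 ?addr0 //.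
    move=> i /eqP ni; rewrite coefZ coefXn; case: eqP => [nE|]; last by rewrite mulr0.
    by case: ni; apply: val_inj; rewrite /= [X in (X %/ _)%N]nE mulnK ?prime_gt0.
  rewrite expr0n gtn_eqF ?prime_gt0 // big1 // => i _.
  rewrite coefZ coefXn; case: eqP => [nE|]; last by rewrite mulr0.
  by rewrite nE dvdn_mull in pn.
have frob := @gauss_le_frobenius _ _ _ absQP p p_prime (@padic_abs_dvd _ _ _ _ p_prime QpP)
  n E IH n.
rewrite coefB SpE -/S in frob.
have : absQ (p%:R * E n) <= p%:R^-1.
  have -> : p%:R * E n = rest - ((S ^+ p)`_n - u ^+ p) - (u ^+ p - u).
    by apply: (addrI (S ^+ p)`_n); rewrite key; ring.
  apply: (absB_le absQP); last exact: padic_fermat.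
  exact: (absB_le absQP).
by rewrite (absM absQP) (padic_abs_p p_prime QpP) -[X in _ <= X]mulr1 ler_pM2l.
Qed.

Variables (K : fieldExtType Qp) (abs : K -> R).
Hypothesis absP : absval_extension absQ abs.
Let absKP := ext_absval absP.

Lemma ext_char0 n : n.+1%:R != 0 :> K.
Proof. by rewrite -scaler_nat scaler_eq0 negb_or char0 oner_neq0. Qed.

Lemma ps_exp_alg (f : nat -> Qp) n :
  ps_exp (fun i => (f i)%:A : K) n = (ps_exp f n)%:A.
Proof.
have iterE k m : iter k (ps_mul (fun i => (f i)%:A : K)) (@ps_one K) m =
    (iter k (ps_mul f) (@ps_one Qp) m)%:A.
  elim: k m => [|k IH] m; first by rewrite /= /ps_one; case: eqP; rewrite ?scale1r ?scale0r.
  rewrite !iterS {1 3}/ps_mul -/(in_alg K _) rmorph_sum; apply: eq_bigr => i _.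
  by rewrite rmorphM IH.
rewrite /ps_exp -/(in_alg K _) rmorph_sum; apply: eq_bigr => k _.
by rewrite iterE -/(in_alg K _) rmorphM fmorphV rmorph_nat.
Qed.

Lemma ps_l_alg n : ps_l K p n = (ps_l Qp p n)%:A.
Proof.
rewrite /ps_l -/(in_alg K _) rmorph_sum; apply: eq_bigr => k _.
by rewrite rmorphXn fmorphV rmorph_nat.
Qed.

(** The dilation by pi factors out and leaves E, whose coefficients lie in Q_p, where integrality is
    known. *)
Lemma ps_hE (pi : K) n : ps_h p pi n = pi ^+ n * (E n)%:A.
Proof.
rewrite /ps_h ps_exp_dilate; [|exact: ext_char0|exact: ps_l0].
rewrite /ps_dilate -ps_exp_alg; congr (_ * ps_exp _ _).
by apply/funext => i; exact: ps_l_alg.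
Qed.

Lemma abs_ps_h (pi : K) n : abs (ps_h p pi n) <= abs pi ^+ n.
Proof.
rewrite ps_hE (absM absKP) (absX absKP) (ext_restr absP) ler_piMr //.
  by rewrite exprn_ge0 ?(abs_ge0 absKP).
exact: artin_hasse_integral.
Qed.

(** Below degree p the series l(pi T) is just pi T, its next term being in T^p. *)
Lemma ps_h_small (pi : K) n : (n < p)%N -> ps_h p pi n = pi ^+ n / n`!%:R.
Proof.
move=> np; apply: (@is_exp_unique _ ext_char0 n (ps_dilate pi (ps_l K p))
  (fun n => pi * (n == 1%N)%:R) _ (fun n => pi ^+ n / n`!%:R)) => //; last exact: (is_exp_linear ext_char0).
  move=> i ni; rewrite /ps_dilate ps_l_small ?(leq_ltn_trans ni) //.
  by case: eqVneq => [->|]; rewrite ?mulr0.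
by apply: (is_expP ext_char0); rewrite /ps_dilate ps_l0 ?mulr0.
Qed.

End ArtinHasse.

(** * Size of the coefficients and of the Schur functions *)

Section SeriesNorm.
Variables (R : realType) (K : fieldType) (abs : K -> R).
Hypothesis absP : nonarch_absval abs.
Implicit Types a u : zseries K.

Lemma HspaceP a : Hspace abs a <-> (exists B, forall i, abs (a i) <= B) /\
  forall e, 0 < e -> exists N, forall n : nat, (N <= n)%N -> abs (a n%:Z) <= e.
Proof.
have H := abs_cvgP absP (fun n : nat => (a n%:Z : K)) 0.
have E : (fun n : nat => abs ((a n%:Z : K) - 0)) = (fun n : nat => abs (a n%:Z)).
  by apply/funext => n; rewrite subr0.
rewrite /abs_cvg E in H; split=> -[aB alim]; split=> //.
  by move=> e e0; have [N HN] := H.1 alim e e0; exists N => n /HN; rewrite subr0.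
by apply/H => e e0; have [N HN] := alim e e0; exists N => n /HN; rewrite subr0.
Qed.

Lemma le_normH a i : (exists B, forall i, abs (a i) <= B) -> abs (a i) <= normH abs a.
Proof.
by move=> [B aB]; apply: ub_le_sup; [exists B => _ [j _ <-]; exact: aB|exists i].
Qed.

Lemma normH_le a e : (forall i, abs (a i) <= e) -> normH abs a <= e.
Proof.
move=> ae; apply: ge_sup; first by exists (abs (a 0)); exists 0.
by move=> _ [j _ <-]; exact: ae.
Qed.

Lemma Gamma_zseries_of_ps (f : nat -> K) rho : 0 <= rho < 1 -> f 0%N = 1 ->
  (forall n, abs (f n) <= rho ^+ n) ->
  Gamma_plus abs (zseries_of_ps f) /\ Gamma_rho abs rho (zseries_of_ps f).
Proof.
move=> /andP[r0 r1] f0 fr; suff G : Gamma_rho abs rho (zseries_of_ps f).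
  split=> //; split => //; last by case.
  by exists rho; rewrite r0 r1.
have bnd i : abs (zseries_of_ps f i) <= 1.
  case: i => [n|n] /=; last by rewrite (abs0 absP).
  by apply: le_trans (fr n) _; rewrite exprn_ile1 // ltW.
split.
- apply/HspaceP; split; first by exists 1.
  move=> e e0; have : `|rho| < 1 by rewrite ger0_norm.
  move=> /cvg_expr/cvgr0Pnorm_le/(_ _ e0)[N _ HN]; exists N => n Nn.
  apply: le_trans (fr n) _; have := HN n Nn; rewrite /= ger0_norm //.
  exact: exprn_ge0.
- move=> /(congr1 (@^~ 0)) /= /eqP; rewrite f0 [X in _ == X](_ : _ = 0 :> K) //.
  by rewrite oner_eq0.
- apply/eqP; rewrite eq_le normH_le //=.
  by rewrite -(abs1 absP) -f0; apply: (@le_normH (zseries_of_ps f) 0); exists 1.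
- by rewrite /= f0 (abs1 absP).
- by move=> i _; exact: fr.
Qed.

Lemma abs_ps_mul_le (f g : nat -> K) rho : 0 <= rho ->
  (forall n, abs (f n) <= rho ^+ n) -> (forall n, abs (g n) <= rho ^+ n) ->
  forall n, abs (ps_mul f g n) <= rho ^+ n.
Proof.
move=> r0 fr gr n; apply: (abs_sum_le absP); first exact: exprn_ge0.
move=> i _; have ni : (i <= n)%N by rewrite -ltnS.
by rewrite (absM absP) -[in leRHS](subnKC ni) exprD; apply: ler_pM; rewrite ?(abs_ge0 absP).
Qed.

Lemma abs_ps_one_le rho n : 0 <= rho -> abs (ps_one K n) <= rho ^+ n.
Proof.
move=> r0; case: n => [|n]; first by rewrite expr0 (abs1 absP).
by rewrite (abs0 absP) exprn_ge0.
Qed.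

Lemma abs_ps_inflate_le (f : nat -> K) m t rho : (0 < m)%N -> 0 <= t -> 0 <= rho ->
  t <= rho ^+ m -> (forall n, abs (f n) <= t ^+ n) ->
  forall n, abs (ps_inflate m f n) <= rho ^+ n.
Proof.
move=> m0 t0 r0 tr ft n; rewrite /ps_inflate; case: ifP => [/dvdnP[q ->]|_].
  rewrite mulnK // mulnC exprM; apply: le_trans (ft q) _.
  by rewrite lerXn2r ?nnegrE ?exprn_ge0.
by rewrite (abs0 absP) exprn_ge0.
Qed.

(** Describes products of series h(T^m; c) with m < g and |c| <= t: each nonconstant coefficient
    carries a factor t, and degree g is out of reach of a single such factor. *)
Definition quadratic_at g (t : R) (f : nat -> K) : Prop :=
  [/\ f 0%N = 1, forall n, (0 < n < g)%N -> abs (f n) <= t & abs (f g) <= t ^+ 2].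

Lemma quadratic_at_mul g t f1 f2 : (0 < g)%N -> 0 <= t -> t <= 1 ->
  quadratic_at g t f1 -> quadratic_at g t f2 -> quadratic_at g t (ps_mul f1 f2).
Proof.
move=> g0 t0 t1 [a0 at1 at2] [b0 bt1 bt2].
have tt : t ^+ 2 <= t by rewrite expr2 ler_piMl.
have ab i n : (0 < i < n)%N -> (n <= g)%N -> abs (f1 i * f2 (n - i)%N) <= t ^+ 2.
  move=> /andP[i0 ni] ng; rewrite (absM absP) expr2.
  by apply: ler_pM; rewrite ?(abs_ge0 absP) ?at1 ?bt1 //; lia.
split.
- by rewrite /ps_mul big_ord1 a0 b0 mulr1.
- move=> n /andP[n0 ng]; apply: (abs_sum_le absP) => // i _.
  have := ltn_ord i; rewrite ltnS => ni.
  have [->|i0] := posnP i; first by rewrite a0 mul1r subn0 bt1 // n0.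
  move: ni; rewrite leq_eqVlt => /predU1P[->|ni].
    by rewrite subnn b0 mulr1 at1 // n0.
  by apply: le_trans tt; apply: ab; rewrite ?i0 // ltnW.
- apply: (abs_sum_le absP) => [|i _]; first exact: exprn_ge0.
  have := ltn_ord i; rewrite ltnS => ni.
  have [->|i0] := posnP i; first by rewrite a0 mul1r subn0 bt2.
  move: ni; rewrite leq_eqVlt => /predU1P[->|ni]; first by rewrite subnn b0 mulr1.
  by apply: ab; rewrite ?i0.
Qed.

Lemma quadratic_at_one g t : (0 < g)%N -> 0 <= t -> quadratic_at g t (ps_one K).
Proof.
move=> g0 t0; rewrite /quadratic_at /ps_one; split => //.
  by move=> [|n] //= _; rewrite (abs0 absP).
by rewrite gtn_eqF // (abs0 absP) exprn_ge0.
Qed.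

Lemma quadratic_at_inflate g t m (f : nat -> K) : (0 < m < g)%N -> 0 <= t -> t <= 1 ->
  f 0%N = 1 -> (forall n, abs (f n) <= t ^+ n) -> quadratic_at g t (ps_inflate m f).
Proof.
move=> /andP[m0 mg] t0 t1 f0 ft; rewrite /quadratic_at /ps_inflate; split.
- by rewrite dvdn0 div0n.
- move=> n /andP[n0 ng]; case: ifP => [/dvdnP[[|q] nE]|_]; last by rewrite (abs0 absP).
    by rewrite nE in n0.
  rewrite nE mulnK //; apply: le_trans (ft _) _; rewrite exprS ler_piMr //.
  exact: exprn_ile1.
- case: ifP => [/dvdnP[[|[|q]] gE]|_].
  + by rewrite gE in mg.
  + by rewrite gE mul1n ltnn in mg.
  + rewrite gE mulnK //; apply: le_trans (ft _) _.
    by rewrite -addn2 exprD ler_piMl ?exprn_ge0 ?exprn_ile1.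
  + by rewrite (abs0 absP) exprn_ge0.
Qed.

End SeriesNorm.

(** * Schur functions of an exponential as Vandermonde determinants *)

Section SchurValues.

Lemma ffact_horner (F : fieldType) (n m : nat) :
  (\prod_(k < m) ('X - k%:R%:P : {poly F})).[n%:R] = (n ^_ m)%:R.
Proof.
elim: m => [|m IH]; first by rewrite big_ord0 hornerC.
rewrite big_ord_recr hornerM IH !hornerE ffactnSr natrM.
have [mn|nm] := leqP m n; first by rewrite natrB.
by rewrite ffact_small // !mul0r.
Qed.

(* The falling factorial [x ^_ j] is a monic polynomial of degree [j] in [x]. *)
Lemma det_ffact (F : fieldType) n (L : 'I_n -> nat) :
  \det (\matrix_(i < n, j < n) ((L i ^_ j)%:R : F)) =
  \prod_(i < n) \prod_(j < n | (i < j)%N) ((L j)%:R - (L i)%:R).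
Proof.
pose P j : {poly F} := \prod_(k < j) ('X - k%:R%:P).
have sP j : size (P j) = j.+1.
  by rewrite size_prod_XsubC /index_enum -enumT size_enum_ord.
have mP j : P j \is monic by exact: monic_prod_XsubC.
pose U := \matrix_(k < n, j < n) (P j)`_k.
have -> : \matrix_(i < n, j < n) ((L i ^_ j)%:R : F) =
    (Vandermonde n (\row_i (L i)%:R))^T *m U.
  apply/matrixP => i j; rewrite !mxE -ffact_horner -/(P j).
  rewrite (@horner_coef_wide _ n) ?sP //; apply: eq_bigr => k _.
  by rewrite !mxE mulrC.
rewrite det_mulmx det_tr det_Vandermonde -[\det U]det_tr det_trig; last first.
  by apply/is_trig_mxP => i j ij; rewrite !mxE nth_default // sP.
rewrite [X in _ * X]big1 ?mulr1 => [|i _].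
  by apply: eq_bigr => i _; apply: eq_bigr => j _; rewrite !mxE.
by rewrite !mxE; have /monicP := mP i; rewrite lead_coefE sP.
Qed.

Variables (R : realType) (p : nat) (K : fieldType) (abs : K -> R).
Hypothesis absP : nonarch_absval abs.
Hypothesis abs_unit : forall n, (0 < n < p)%N -> abs n%:R = 1.

Lemma abs_fact_unit n : (n < p)%N -> abs n`!%:R = 1.
Proof.
elim: n => [|n IH] np; first by rewrite (abs1 absP).
by rewrite factS natrM (absM absP) abs_unit // IH ?mulr1 // ltnW.
Qed.

(** Counting from 0, let L_i = kappa_i + n - 1 - i. Reversing the columns turns the entries into
    pi^(L_i - j) / (L_i - j)!, that is pi^(L_i) / L_i! times the falling factorial of L_i times
    pi^(-j): a matrix of falling factorials between two diagonal ones. The bound by p gives L_i < p,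
    so that the factorials and the differences of the L_i are units. *)
Lemma abs_schur_exp (h : nat -> K) (pi : K) (kappa : seq nat) : pi != 0 ->
  (forall n, (n < p)%N -> h n = pi ^+ n / n`!%:R) ->
  sorted geq kappa -> (nth 0 kappa 0 + size kappa <= p)%N ->
  abs (schur kappa (zseries_of_ps h)) = abs pi ^+ sumn kappa.
Proof.
move=> pi0 hE kap kp; set n := size kappa.
have kapS i j : (i <= j)%N -> (j < n)%N -> (nth 0 kappa j <= nth 0 kappa i)%N.
  move=> ij jn; apply: (sorted_leq_nth _ _ 0%N kap) => //; rewrite ?inE //.
  - by move=> x y z /= xy yz; exact: leq_trans xy.
  - by move=> x /=.
  - exact: leq_ltn_trans ij jn.
pose L (i : 'I_n) := (nth 0 kappa i + (n - i.+1))%N.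
have Lp i : (L i < p)%N.
  apply: leq_trans kp; rewrite /L; have := kapS 0%N i (leq0n _) (ltn_ord i).
  by have := ltn_ord i; rewrite -/n; lia.
pose s : 'S_n := perm (@rev_ord_inj n).
rewrite /schur; set M := \matrix_(i, j) _.
have detM : abs (\det M) = abs (\det (col_perm s M)).
  rewrite col_permE det_mulmx det_perm (absM absP) (absX absP) (absN absP) (abs1 absP).
  by rewrite expr1n mulr1.
have ME : col_perm s M = diag_mx (\row_i (pi ^+ L i / (L i)`!%:R)) *m
    (\matrix_(i < n, j < n) ((L i ^_ j)%:R : K)) *m diag_mx (\row_j (pi ^- j)).
  apply/matrixP => i j; rewrite mul_mx_diag mul_diag_mx !mxE permE /=.
  have -> : (nth 0%N kappa i)%:Z - i%:Z + (n - j.+1)%:Z = (L i)%:Z - j%:Z.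
    by rewrite /L; case: i j => [i il] [j jl] /=; lia.
  (* For j > L_i both sides vanish: the falling factorial, and the coefficient of h at a negative
     index. *)
  have [jL|Lj] := leqP j (L i); last first.
    rewrite ffact_small // mulr0 mul0r.
    by have [k ->] : exists k, (L i)%:Z - j%:Z = Negz k
      by exists (j - L i).-1; rewrite NegzE; lia.
  rewrite subzn //= hE ?(leq_ltn_trans (leq_subr _ _)) //.
  have : (L i)`!%:R != 0 :> K.
    by apply/eqP => /(absval_eq0 absP)/eqP; rewrite abs_fact_unit // oner_eq0.
  rewrite -(ffact_fact jL) natrM mulf_eq0 negb_or => /andP[x0 y0].
  rewrite -[in X in _ = X / _ * _ * _](subnK jL) exprD.
  have z0 := expf_neq0 j pi0; move: (pi ^+ j) (pi ^+ _) z0 x0 y0 => z w z0.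
  move: (_%:R) (_%:R) => x y x0 y0; field.
  by rewrite x0 y0 z0.
rewrite detM ME !det_mulmx !det_diag det_ffact !(absM absP) !(abs_prod absP).
have -> : \prod_(i < n) abs (\prod_(j < n | (i < j)%N) ((L j)%:R - (L i)%:R)) = 1.
  rewrite big1 // => i _; rewrite (abs_prod absP) big1 // => j ij.
  have LL : (L j < L i)%N.
    by have := kapS i j (ltnW ij) (ltn_ord j); have := ltn_ord j; rewrite /L; lia.
  rewrite -(absN absP) opprB -natrB ?(ltnW LL) // abs_unit //.
  by rewrite subn_gt0 LL (leq_ltn_trans (leq_subr _ _)).
rewrite mulr1 -big_split /=.
have -> : \prod_(i < n) (abs ((\row_i0 (pi ^+ L i0 / (L i0)`!%:R)) 0 i) *
    abs ((\row_j (pi ^- j)) 0 i)) = \prod_(i < n) (abs pi ^+ L i / abs pi ^+ i).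
  apply: eq_bigr => i _; rewrite !mxE (absM absP) !(absV absP) !(absX absP).
  by rewrite abs_fact_unit // invr1 mulr1.
rewrite big_split /= prodrXr prodfV prodrXr.
have a0 : abs pi != 0 by rewrite gt_eqF // (abs_gt0 absP).
apply: (mulIf (expf_neq0 (\sum_(i < n) i)%N a0)); rewrite mulfVK ?expf_neq0 // -exprD.
congr (_ ^+ _); rewrite big_split /=; congr (_ + _)%N; first by rewrite sumnE (big_nth 0%N) big_mkord.
by rewrite [RHS](reindex_inj rev_ord_inj).
Qed.

End SchurValues.

(** * Closedness of the points of the analytic Grassmannian *)

Section AnalyticGrassmannian.
Variables (R : realType) (K : fieldType) (abs : K -> R).
Hypotheses (absP : nonarch_absval abs) (Kcomplete : abs_complete abs).
Implicit Types x y u : zseries K.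

Definition zball (e : R) u : Prop := forall i, abs (u i) <= e.

Lemma zballB e u v : zball e u -> zball e v -> zball e (u - v).
Proof. by move=> ue ve i; exact: (absB_le absP). Qed.

Lemma zballZ e c u : zball e u -> zball (abs c * e) (c *: u).
Proof.
move=> ue i; rewrite [X in abs X](_ : _ = c * u i) // (absM absP).
by rewrite ler_wpM2l ?(abs_ge0 absP).
Qed.

Lemma zball_le e e' u : e <= e' -> zball e u -> zball e' u.
Proof. by move=> ee' ue i; exact: le_trans ee'. Qed.

Lemma zball_sep u : (forall e, 0 < e -> zball e u) -> u = 0.
Proof. by move=> H; apply/funext => i; apply: (eq0_abs_le absP) => e e0; exact: H. Qed.

Lemma zball_ge0 e u : zball e u -> 0 <= e.
Proof. by move=> /(_ 0); apply: le_trans; exact: abs_ge0 absP _. Qed.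

Lemma Hspace_lin c x y : Hspace abs x -> Hspace abs y -> Hspace abs (c *: x + y).
Proof.
move=> /(HspaceP absP)[[B xB] x0] /(HspaceP absP)[[B' yB'] y0].
have cxy i e e' : abs (x i) <= e -> abs (y i) <= e' ->
    abs ((c *: x + y) i) <= Num.max ((abs c + 1) * e) e'.
  move=> xe ye; apply: (absD_le absP); last by rewrite le_max ye orbT.
  rewrite [X in abs X](_ : _ = c * x i) // (absM absP) le_max; apply/orP; left.
  apply: ler_pM; rewrite ?(abs_ge0 absP) //.
  by rewrite lerDl.
apply/(HspaceP absP); split; first by exists (Num.max ((abs c + 1) * B) B') => i; exact: cxy.
have c1 : 0 < abs c + 1 by rewrite ltr_wpDl ?(abs_ge0 absP).
move=> e e0; have [N HN] := x0 _ (divr_gt0 e0 c1); have [N' HN'] := y0 _ e0.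
exists (maxn N N') => n; rewrite geq_max => /andP[/HN xn /HN' yn].
apply: le_trans (cxy _ _ _ xn yn) _.
by rewrite mulrCA mulfV ?mulr1 ?maxxx // gt_eqF.
Qed.

Lemma Hplus_lin c x y : Hplus abs x -> Hplus abs y -> Hplus abs (c *: x + y).
Proof.
move=> [Hx x0] [Hy y0]; split; first exact: Hspace_lin.
by move=> i i0; rewrite [LHS](_ : _ = c * x i + y i) // x0 // y0 // mulr0 addr0.
Qed.

Lemma HplusB x y : Hplus abs x -> Hplus abs y -> Hplus abs (x - y).
Proof. by move=> Hx Hy; rewrite addrC -scaleN1r; exact: Hplus_lin. Qed.

Lemma Hplus0 : Hplus abs 0.
Proof.
split=> //; apply/(HspaceP absP); split; first by exists 0 => i; rewrite (abs0 absP).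
by move=> e /ltW e0; exists 0%N => n _; rewrite (abs0 absP).
Qed.

Lemma Hplus_complete : ball_complete zball (Hplus abs).
Proof.
move=> u Hu ucau.
have /choice[l ul] : forall i, exists l : K, abs_cvg abs (fun n => (u n i : K)) l.
  move=> i; apply: Kcomplete => e e0; have e20 : 0 < e / 2 by rewrite divr_gt0.
  have [N HN] := ucau _ e20; exists N => m n Nm Nn.
  apply: le_lt_trans (HN m n Nm Nn i) _.
  by rewrite ltr_pdivrMr // mulr_natr mulr2n ltrDl.
have unl : ball_cvg zball u l.
  move=> e e0; have [N HN] := ucau _ e0; exists N => n Nn i.
  have /(abs_cvgP absP)/(_ _ e0)[M HM] := ul i.
  have -> : (u n - (l : zseries K)) i = (u n - u (maxn N M)) i + (u (maxn N M) i - l i : K).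
    by rewrite !fctE addrA subrK.
  apply: (absD_le absP); first exact: (HN _ _ Nn (leq_maxl _ _)).
  exact: HM (leq_maxr _ _).
exists (l : zseries K) => //; split; last first.
  move=> i i0; apply: (abs_cvg_unique absP (ul i)); apply/(abs_cvgP absP) => e /ltW e0.
  by exists 0%N => n _; have [_ ->] := Hu n; rewrite // subr0 (abs0 absP).
have lE n i : l i = u n i - (u n - (l : zseries K)) i :> K by rewrite !fctE subKr.
apply/(HspaceP absP); split.
  have [N HN] := unl _ ltr01; have [/(HspaceP absP)[[B HB] _] _] := Hu N.
  exists (Num.max B 1) => i; rewrite (lE N i); apply: (absB_le absP).
    by rewrite le_max HB.
  by rewrite le_max HN ?orbT.
move=> e e0; have [N HN] := unl _ e0; have [/(HspaceP absP)[_ lim] _] := Hu N.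
have [M HM] := lim e e0; exists M => n Mn; rewrite (lE N n%:Z).
by apply: (absB_le absP); [exact: HM|exact: HN].
Qed.

Lemma linear_on_HplusB S w x y : linear_on_Hplus abs S w ->
  Hplus abs x -> Hplus abs y -> w (x - y) = w x - w y.
Proof.
by move=> [_ wlin] Hx Hy; rewrite addrC -scaleN1r wlin // scaleN1r addrC.
Qed.

Lemma linear_on_Hplus0 S w : linear_on_Hplus abs S w -> w 0 = 0.
Proof.
move=> wlin; rewrite -[X in w X](subrr 0) (linear_on_HplusB wlin) ?subrr //;
  exact: Hplus0.
Qed.

(** The inclusion of S in [Hspace] makes [w x] bounded, so that [normH] really dominates its
    coefficients. *)
Lemma opnorm_zball S w C e x : linear_on_Hplus abs S w -> S `<=` Hspace abs ->
  0 <= C -> opnorm_le abs w C -> Hplus abs x -> zball e x -> zball (C * e) (w x).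
Proof.
move=> [wS _] SH C0 wC Hx xe i.
have /SH/(HspaceP absP)[wb _] := wS x Hx.
apply: le_trans (le_normH _ wb) _; apply: le_trans (wC x Hx) _.
by rewrite ler_wpM2l // normH_le.
Qed.

Lemma opnorm_max0 w C : opnorm_le abs w C -> opnorm_le abs w (Num.max C 0).
Proof.
move=> wC x Hx; apply: le_trans (wC x Hx) _; rewrite ler_wpM2r ?le_max ?lexx //.
have [/(HspaceP absP)[xb _] _] := Hx.
exact: le_trans (abs_ge0 absP _) (le_normH 0 xb).
Qed.

Section ImageComplete.
Variables (w w1 w2 : zseries K -> zseries K) (i0 : int).
Hypotheses (wlin : linear_on_Hplus abs (Hspace abs) w)
  (w1lin : linear_on_Hplus abs (Hminus abs) w1) (w1norm : opnorm_le abs w1 1)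
  (w2lin : linear_on_Hplus abs (Hplus abs) w2) (w2norm : opnorm_le abs w2 1)
  (wE : forall x, Hplus abs x -> shiftT i0 (w x) = w1 x + (x + w2 x)).

Let HminusH : Hminus abs `<=` Hspace abs. Proof. by move=> x []. Qed.
Let HplusH : Hplus abs `<=` Hspace abs. Proof. by move=> x []. Qed.

Let wcoef x i : Hplus abs x -> w x i = w1 x (i + i0) + (x (i + i0) + w2 x (i + i0)) :> K.
Proof. by move=> /wE/(congr1 (@^~ (i + i0))); rewrite /shiftT addrK. Qed.

Let wball e x : Hplus abs x -> zball e x -> zball e (w x).
Proof.
move=> Hx xe i; rewrite wcoef //; apply: (absD_le absP).
  by rewrite -[e]mul1r; apply: (opnorm_zball w1lin).
apply: (absD_le absP) => //; rewrite -[e]mul1r.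
exact: (opnorm_zball w2lin).
Qed.

Variables (F : zseries K -> zseries K) (C : R).
Hypotheses (Flin : linear_on_Hplus abs (Hplus abs) F) (Fnorm : opnorm_le abs F C)
  (w2F : opnorm_le abs (fun x => w2 x - F x) (1 / 2)).

(* On the kernel of [F] one has [w2 = w2 - F], of norm at most 1/2, so that
   [1 + w2] is isometric there by the ultrametric inequality. *)
Lemma zball_of_image e x : Hplus abs x -> F x = 0 -> zball e (w x) -> zball e x.
Proof.
move=> Hx Fx wxe; have e0 := zball_ge0 wxe.
have [/(HspaceP absP)[xb _] x0] := Hx.
have N0 := le_trans (abs_ge0 absP _) (le_normH 0 xb).
(* In positive degrees [w1 x] has no coefficient, so there [w x] is a shift of x + w2 x. The
   resulting ||x|| <= max(e, ||x||/2) forces ||x|| <= e. *)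
have le i : abs (x i) <= Num.max e (1 / 2 * normH abs x).
  have [i0le|ipos] := leP i 0; first by rewrite x0 // (abs0 absP) le_max e0.
  have := wxe (i - i0); rewrite wcoef // subrK.
  have [_ ->] := (w1lin.1 x Hx); rewrite // add0r => xw.
  rewrite -[X in abs X](addrK (w2 x i)); apply: (absB_le absP).
    by rewrite le_max xw.
  have := w2F Hx; rewrite Fx subr0 => w2x.
  rewrite le_max; apply/orP; right; apply: le_trans w2x.
  by apply: le_normH; have [/(HspaceP absP)[]] := w2lin.1 x Hx.
have : normH abs x <= e.
  have := normH_le le; rewrite le_max => /orP[//|].
  rewrite -subr_ge0 -{2}[normH abs x]mul1r -mulrBl => H.
  have -> : normH abs x = 0 by apply/eqP; rewrite eq_le N0 andbT; move: H; lra.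
  exact: e0.
by move=> xe i; apply: le_trans xe; exact: le_normH.
Qed.

(** Preimages of a Cauchy sequence are Cauchy by [zball_of_image], and their limit stays in the
    kernel because F is bounded. *)
Lemma image_ker_complete : ball_complete zball (w @` [set x | Hplus abs x /\ F x = 0]).
Proof.
move=> u Hu ucau.
have /choice[x Hx] : forall n, exists x, [/\ Hplus abs x, F x = 0 & w x = u n].
  by move=> n; have [x [Hx Fx] wx] := Hu n; exists x.
have xcau : ball_cauchy zball x.
  move=> e e0; have [N HN] := ucau e e0; exists N => m n Nm Nn.
  have [Hm Fm um] := Hx m; have [Hn Fn un] := Hx n.
  apply: zball_of_image; first exact: HplusB.
    by rewrite (linear_on_HplusB Flin) // Fm Fn subrr.
  by rewrite (linear_on_HplusB wlin) // um un; exact: HN.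
have xH n : Hplus abs (x n) by have [] := Hx n.
have [l Hl xl] := Hplus_complete xH xcau.
exists (w l); last first.
  move=> e e0; have [N HN] := xl e e0; exists N => n Nn; have [_ _ <-] := Hx n.
  rewrite -(linear_on_HplusB wlin) //; apply: wball; last exact: HN.
  exact: HplusB.
exists l => //; split=> //; apply: zball_sep => e e0.
have M0 : 0 <= Num.max C 0 by rewrite le_max lexx orbT.
have M1 : 0 < Num.max C 0 + 1 by rewrite ltr_wpDl.
have [N HN] := xl _ (divr_gt0 e0 M1).
have -> : F l = - (F (x N) - F l) by have [_ -> _] := Hx N; rewrite sub0r opprK.
rewrite -(linear_on_HplusB Flin) // => i; rewrite (absN absP).
apply: le_trans (opnorm_zball Flin HplusH M0 (opnorm_max0 Fnorm) _ (HN N (leqnn _)) i) _.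
  exact: HplusB.
by rewrite mulrCA ler_piMr ?(ltW e0) // ler_pdivrMr // mul1r lerDl.
Qed.

Variables (n : nat) (b : 'I_n -> zseries K).
Hypothesis Frank : forall x, Hplus abs x -> exists c : 'I_n -> K, F x = \sum_i c i *: b i.

(** Extended by 0 to all natural indices, to allow induction on the number of vectors. *)
Let bn i : zseries K := if insub i is Some j then b j else 0.

(* The kernel of [F] has finite codimension in H_+: its image is completed one
   line at a time. *)
Lemma image_Hplus_complete : ball_complete zball (w @` Hplus abs).
Proof.
pose Z m := [set x | Hplus abs x /\ exists c : nat -> K, F x = \sum_(i < m) c i *: bn i].
have Zlin m c x y : Z m x -> Z m y -> Z m (c *: x + y).
  move=> [Hx [cx Fx]] [Hy [cy Fy]]; split; first exact: Hplus_lin.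
  exists (fun i => c * cx i + cy i); rewrite Flin.2 // Fx Fy scaler_sumr -big_split.
  by apply: eq_bigr => i _; rewrite scalerDl scalerA.
have Z0 m : Z m 0.
  split; first exact: Hplus0.
  exists (fun=> 0); rewrite (linear_on_Hplus0 Flin) big1 // => i _.
  by rewrite scale0r.
have wZ m : ball_complete zball (w @` Z m).
  elim: m => [|m IH].
    have -> : Z 0%N = [set x | Hplus abs x /\ F x = 0]; last exact: image_ker_complete.
    apply/seteqP; split => x [Hx].
      by move=> [c]; rewrite big_ord0.
    by move=> Fx; split=> //; exists (fun=> 0); rewrite big_ord0.
  (* The b_i may be dependent, so the c_i are not unique. Either some x0 admits c_m != 0 and Z (m+1)
     = Z m + K x0, or Z (m+1) = Z m. *)
  have [[x0 [Hx0 [c0 [Fx0 c00]]]]|no] := pselect (exists x0, Hplus abs x0 /\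
      exists c : nat -> K, F x0 = \sum_(i < m.+1) c i *: bn i /\ c m != 0); last first.
    suff -> : Z m.+1 = Z m by [].
    apply/seteqP; split => x [Hx [c Fx]]; split=> //.
      exists c; rewrite Fx big_ord_recr /=; have [cm|cm] := eqVneq (c m) 0.
        by rewrite cm scale0r addr0.
      by case: no; exists x; split=> //; exists c.
    exists (fun i => if i == m then 0 else c i).
    rewrite big_ord_recr /= eqxx scale0r addr0 Fx; apply: eq_bigr => i _.
    by rewrite ltn_eqF.
  have -> : w @` Z m.+1 =
      [set v | exists2 z, (w @` Z m) z & exists a, v = z + a *: w x0].
    apply/seteqP; split.
      move=> _ [x [Hx [c Fx]] <-]; pose a := c m / c0 m.
      exists (w (- a *: x0 + x)); last first.
        by exists a; rewrite wlin.2 // scaleNr addrC addrA subrr add0r.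
      exists (- a *: x0 + x) => //; split; first exact: Hplus_lin.
      exists (fun i => - a * c0 i + c i).
      rewrite Flin.2 // Fx Fx0 scaler_sumr -big_split big_ord_recr /=.
      rewrite [X in _ + X](_ : _ = 0) ?addr0; last first.
        by rewrite scalerA -scalerDl mulNr mulfVK // addNr scale0r.
      by apply: eq_bigr => i _; rewrite scalerDl scalerA.
    move=> _ [_ [x [Hx [c Fx]] <-] [a ->]]; exists (a *: x0 + x).
      apply: Zlin; first by split=> //; exists c0.
      split=> //; exists (fun i => if i == m then 0 else c i).
      rewrite big_ord_recr /= eqxx scale0r addr0 Fx; apply: eq_bigr => i _.
      by rewrite ltn_eqF.
    by rewrite wlin.2 // addrC.
  have /(HspaceP absP)[[D HD] _] := wlin.1 _ Hx0.
  apply: (complete_add_line absP Kcomplete zballB zballZ zball_le zball_sep _ _ _ IH (C := D)).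
  - by exists 0; [exact: Z0|rewrite (linear_on_Hplus0 wlin)].
  - move=> c _ _ [x Zx <-] [y Zy <-]; exists (c *: x + y); first exact: Zlin.
    by rewrite wlin.2 //; [case: Zx|case: Zy].
  - exact: HD.
suff -> : Hplus abs = Z n by exact: wZ.
apply/seteqP; split => x; last by case.
move=> Hx; split=> //; have [c ->] := Frank Hx.
exists (fun i => if insub i is Some j then c j else 0).
by apply: eq_bigr => i _; rewrite /bn valK.
Qed.

End ImageComplete.

Lemma Gr_an_complete W : Gr_an abs W -> ball_complete zball W.
Proof.
move=> [w [wlin _ -> [i0 [w1 [w2 [[w1lin w1n] [w2lin w2n] [F [HF Flim]] wE]]]]]].
(* Any constant below 1 would do, and a single approximation F is enough. *)
have h0 : 0 < 1 / 2 :> R by rewrite divr_gt0.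
have [N /(_ N (leqnn _)) w2F] := Flim _ h0; have [Flin [C FC] [n [b Frank]]] := HF N.
exact: (image_Hplus_complete wlin w1lin w1n w2lin w2n wE Flin FC w2F Frank).
Qed.

Lemma Gr_an_lin W c x y : Gr_an abs W -> W x -> W y -> W (c *: x + y).
Proof.
move=> [w [wlin _ -> _]] [x' Hx <-] [y' Hy <-].
by exists (c *: x' + y'); [exact: Hplus_lin|rewrite wlin.2].
Qed.

Lemma Gr_an0 W : Gr_an abs W -> W 0.
Proof.
by move=> [w [wlin _ -> _]]; exists 0; [exact: Hplus0|rewrite (linear_on_Hplus0 wlin)].
Qed.

Lemma Gr_an_sub W : Gr_an abs W -> W `<=` Hspace abs.
Proof. by move=> [w [[wH _] _ -> _]] _ [x Hx <-]; exact: wH. Qed.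

End AnalyticGrassmannian.

(** * Transversality *)

Section CramerBound.
Variables (R : realType) (K : fieldType) (abs : K -> R).
Hypothesis absP : nonarch_absval abs.

(** All Leibniz terms have the same bound, a permutation only reordering the column weights. *)
Lemma abs_det_le n (A : 'M[K]_n) (a b : 'I_n -> R) :
  (forall i, 0 <= a i) -> (forall i, 0 <= b i) ->
  (forall i j, abs (A i j) <= b i * a j) ->
  abs (\det A) <= (\prod_i b i) * \prod_i a i.
Proof.
move=> a0 b0 Aab; apply: (abs_sum_le absP) => [|s _].
  by rewrite mulr_ge0 ?prodr_ge0.
rewrite (absM absP) (absX absP) (absN absP) (abs1 absP) expr1n mul1r (abs_prod absP).
rewrite [X in _ * X](reindex_inj (@perm_inj _ s)) -big_split.
by apply: ler_prod => i _; rewrite (abs_ge0 absP) Aab.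
Qed.

(** In det(M) c_i = sum_j (cM)_j adj(M)_(ji), the cofactor bound lacks the weights b_i and a_j. The
    bound on (cM)_j restores a_j, and dividing by det(M), which is as large as the weights allow,
    leaves X / b_i. *)
Lemma cramer_bound n (M : 'M[K]_n) (c : 'rV[K]_n) (a b : 'I_n -> R) X :
  0 <= X -> (forall i, 0 < a i) -> (forall i, 0 < b i) ->
  (forall i j, abs (M i j) <= b i * a j) ->
  abs (\det M) = (\prod_i b i) * \prod_i a i ->
  (forall j, abs ((c *m M) 0 j) <= a j * X) ->
  forall i, abs (c 0 i) <= X / b i.
Proof.
move=> X0 a0 b0 Mab detM cM i.
have a0' j : 0 <= a j by exact: ltW.
have b0' j : 0 <= b j by exact: ltW.
have A0 : 0 < \prod_j a j by apply: prodr_gt0.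
have B0 : 0 < \prod_j b j by apply: prodr_gt0.
have := congr1 (fun N : 'rV_n => N 0 i) (mulmxA c M (\adj M)).
rewrite mul_mx_adj mul_mx_scalar mxE [RHS]mxE => /(congr1 abs).
rewrite (absM absP) detM => detc.
have : abs (\sum_j (c *m M) 0 j * (\adj M) j i) <=
    (\prod_j b j) * (\prod_j a j) * (X / b i).
  apply: (abs_sum_le absP) => [|j _].
    by rewrite !mulr_ge0 ?invr_ge0 // ltW.
  rewrite (absM absP).
  have adjle : abs ((\adj M) j i) <= (\prod_k b (lift i k)) * \prod_k a (lift j k).
    rewrite mxE /cofactor (absM absP) (absX absP) (absN absP) (abs1 absP) expr1n mul1r.
    by apply: abs_det_le => // k l; rewrite !mxE.
  apply: le_trans (ler_pM (abs_ge0 absP _) (abs_ge0 absP _) (cM j) adjle) _.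
  rewrite (bigD1_ord i) //= (bigD1_ord (F := a) j) //=.
  move: (\prod_k _) (\prod_k _) => x y.
  by rewrite le_eqVlt; apply/orP; left; apply/eqP; field; rewrite gt_eqF.
by rewrite -detc ler_pM2l // mulr_gt0.
Qed.

End CramerBound.

(** * The contraction argument for an element x with h x of low degree *)

Section LoopAction.
Variables (R : realType) (K : fieldType) (abs : K -> R).
Hypotheses (absP : nonarch_absval abs) (Kcomplete : abs_complete abs).
Variables (h : nat -> K) (rho : R).
Hypotheses (rho0 : 0 < rho) (rho1 : rho < 1) (h_le : forall n, abs (h n) <= rho ^+ n).

Lemma rho_pow_small C e : 0 <= C -> 0 < e ->
  exists N, forall n, (N <= n)%N -> rho ^+ n * C <= e.
Proof.
move=> C0 e0; have C1 : 0 < C + 1 by rewrite ltr_wpDl.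
have : `|rho| < 1 by rewrite ger0_norm // ltW.
move=> /cvg_expr/cvgr0Pnorm_le/(_ _ (divr_gt0 e0 C1))[N _ HN]; exists N => n Nn.
have := HN n Nn; rewrite /= ger0_norm ?exprn_ge0 ?(ltW rho0) // => rn.
apply: le_trans (ler_pM _ C0 rn (ler_wpDr ler01 (lexx C))) _.
  by rewrite exprn_ge0 ?(ltW rho0).
by rewrite mulfVK // gt_eqF.
Qed.

(** As h has no negative powers, the symmetric sums reduce to one-sided ones, which converge since
    |h_m| <= rho^m. Existence of the limit rules out the default value in [mulH]. *)
Lemma mulH_cvg (x : zseries K) C k : (forall i, abs (x i) <= C) ->
  abs_cvg abs (fun N : nat => \sum_(m < N.+1) h m * (x (k - m%:Z) : K))
    (mulH abs (zseries_of_ps h) x k).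
Proof.
move=> xC; have C0 : 0 <= C by apply: le_trans (xC 0); exact: abs_ge0 absP _.
rewrite /mulH.
have -> : (fun N : nat => \sum_(j < N.*2.+1)
     (zseries_of_ps h (j%:Z - N%:Z) : K) * x (k - (j%:Z - N%:Z))) =
   (fun N : nat => \sum_(m < N.+1) h m * (x (k - m%:Z) : K)).
  apply/funext => N.
  rewrite -(big_mkord xpredT (fun j : nat =>
    (zseries_of_ps h (j%:Z - N%:Z) : K) * x (k - (j%:Z - N%:Z)))).
  rewrite (@big_cat_nat _ _ _ N) //=; last by lia.
  rewrite [X in X + _]big_nat [X in X + _]big1 ?add0r => [|j jN].
    rewrite -{1}[N]add0n big_addn (_ : N.*2.+1 - N = N.+1)%N; last by lia.
    by rewrite big_mkord; apply: eq_bigr => j _; rewrite PoszD addrK.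
  have [q ->] : exists q, j%:Z - N%:Z = Negz q.
    by exists (N - j).-1; rewrite NegzE; lia.
  by rewrite mul0r.
apply: (@xgetPex K 0 [set l | abs_cvg abs _ l]); apply: Kcomplete.
apply: (abs_cauchy_increments absP) => e e0.
have [N HN] := rho_pow_small C0 e0; exists N => n Nn.
rewrite [X in abs (X - _)]big_ord_recr /= addrAC subrr add0r (absM absP).
apply: le_trans (HN n.+1 _); last by rewrite leqW.
by apply: ler_pM; rewrite ?(abs_ge0 absP).
Qed.

Lemma mulH0 : mulH abs (zseries_of_ps h) 0 = 0.
Proof.
apply/funext => k; have := @mulH_cvg 0 0 k _.
move=> /(_ (fun i => _)) H; apply: (abs_cvg_unique absP (H _)).
  by move=> i; rewrite (abs0 absP).
apply/(abs_cvgP absP) => e /ltW e0; exists 0%N => n _.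
by rewrite big1 ?subr0 ?(abs0 absP) // => i _; rewrite mulr0.
Qed.

Lemma abs_zseries_of_ps_le t : abs (zseries_of_ps h t : K) <= rho ^ t.
Proof.
case: t => n; first exact: h_le.
by rewrite /= (abs0 absP) exprz_ge0 // ltW.
Qed.

Lemma exprz_anti (m n : int) : m <= n -> rho ^ n <= rho ^ m.
Proof.
move=> mn; rewrite -(subrK m n) expfzDr ?gt_eqF // ler_piMl ?exprz_ge0 ?(ltW rho0) //.
have : 0 <= n - m by rewrite subr_ge0.
by case: (n - m) => // k _; rewrite -exprnP exprn_ile1 ?(ltW rho0) ?(ltW rho1).
Qed.

Variables (kappa : seq nat) (ix : int) (s : nat -> int).
Hypothesis s_inc : forall i j, (i < j)%N -> s i < s j.
Hypothesis sE : forall j, s j + ix = j.+1%:Z - (nth 0%N kappa j)%:Z.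
Hypothesis schur_h : abs (schur kappa (zseries_of_ps h)) = rho ^+ sumn kappa.
Hypothesis h0 : h 0%N = 1.
Let n := size kappa.

Variables (x : zseries K) (C : R) (v : nat -> zseries K).
Hypothesis xC : forall i, abs (x i) <= C.
Hypothesis hx0 : forall k : int, - ix < k -> mulH abs (zseries_of_ps h) x k = 0.
Hypothesis v_le : forall l i, abs (v l i) <= 1.
Hypothesis v_deg : forall l (i : int), s l < i -> v l i = 0.
Hypothesis xv : ball_cvg (zball abs) (fun N => \sum_(j < N) (x (s j) : K) *: v j) x.

Let s_inj i j : s i = s j -> i = j.
Proof.
by move=> sij; case: (ltngtP i j) => // /s_inc; rewrite sij ltxx.
Qed.

Let s_big j : (n <= j)%N -> s j + ix = j.+1%:Z.
Proof. by move=> nj; rewrite sE nth_default // subr0. Qed.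

(** The weight is matched to |h_m| <= rho^m: in the coefficient of T^(k - ix) of h x, every product
    h_m x(k - ix - m) gets the same bound rho^k X. *)
Let off_le (X : R) := forall t : int, (forall j, s j != t) -> abs (x t) <= rho ^ (t + ix) * X.
Let on_le (X : R) := forall l, abs (x (s l)) <= rho ^ (s l + ix) * X.

(* The coefficient of T^(k - ix) in [h x = 0], with the positions outside the range
   of [s] moved to the other side. *)
Lemma partial_sum_le (X : R) k J : 0 <= X -> off_le X -> (0 < k)%N ->
  (forall j, (J <= j)%N -> k%:Z < s j + ix) ->
  abs (\sum_(j < J) (zseries_of_ps h (k%:Z - (s j + ix)) : K) * x (s j)) <= rho ^+ k * X.
Proof.
move=> X0 off k0 Jk; have rkX : 0 <= rho ^+ k * X by rewrite mulr_ge0 ?exprn_ge0 ?(ltW rho0).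
apply: (abs_le_eps _ rkX) => d d0.
have := @mulH_cvg x C (k%:Z - ix) xC; rewrite hx0; last by lia.
move=> /(abs_cvgP absP)/(_ _ d0)[N0 HN0].
(* Since k - (s_j + ix) = k - j - 1 + kappa_(j+1) <= k + kappa_(j+1), the partial sum up to N
   reaches every s_j with j < J that contributes. *)
pose N := maxn N0 (\max_(j < J) (k + nth 0 kappa j))%N.
have := HN0 N (leq_maxl _ _); rewrite subr0; set SN := \sum_(m < _) _ => SNd.
pose G (m : nat) : K := h m * x (k%:Z - ix - m%:Z).
have LE : \sum_(j < J) (zseries_of_ps h (k%:Z - (s j + ix)) : K) * x (s j) =
    \sum_(m < N.+1) \sum_(j < J | s j == k%:Z - ix - m%:Z) G m.
  rewrite (exchange_big_dep xpredT) //=; apply: eq_bigr => j _.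
  have [sk|sk] := leP (s j + ix) k%:Z; last first.
    have [q ->] : exists q, k%:Z - (s j + ix) = Negz q.
      have := subr_gt0 k%:Z (s j + ix); rewrite sk => /gtz0_abs sE'.
      exists (absz (s j + ix - k%:Z)%R).-1; rewrite NegzE; lia.
    by rewrite mul0r big1 // => m /eqP sm; lia.
  have [m mE] : exists m : nat, k%:Z - (s j + ix) = m.
    by exists (absz (k%:Z - (s j + ix))%R); lia.
  have mN : (m < N.+1)%N.
    rewrite ltnS leq_max; apply/orP; right.
    apply: leq_trans (leq_bigmax j); have := sE j; lia.
  rewrite (big_pred1 (Ordinal mN)) => [|m']; last first.
    by apply/eqP/eqP => [sm|->] /=; [apply: val_inj => /=; lia|lia].
  by rewrite /G /= mE /=; congr (_ * x _); lia.
have -> : \sum_(j < J) (zseries_of_ps h (k%:Z - (s j + ix)) : K) * x (s j) =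
    SN - (SN - \sum_(m < N.+1) \sum_(j < J | s j == k%:Z - ix - m%:Z) G m).
  by rewrite LE subKr.
apply: (absB_le absP); first by rewrite le_max SNd orbT.
rewrite le_max; apply/orP; left; rewrite -sumrB; apply: (abs_sum_le absP) => // m _.
(* If position k - ix - m is some s_j with j < J, that j is unique and the two terms cancel;
   otherwise it is no s_j at all, those with j >= J lying too far up. *)
have [[j /eqP jm]|noj] := pselect (exists j : 'I_J, s j == k%:Z - ix - m%:Z).
  rewrite (big_pred1 j) ?subrr ?(abs0 absP) // => j'.
  by apply/eqP/eqP => [sj'|->] //; apply/val_inj/s_inj; rewrite sj' jm.
rewrite big1 ?subr0 => [|j jm]; last by case: noj; exists j.
have /off xle : forall j, s j != k%:Z - ix - m%:Z.
  move=> j; apply/eqP => jm; have [jJ|/Jk] := ltnP j J; last by lia.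
  by case: noj; exists (Ordinal jJ); rewrite /= jm.
rewrite (absM absP); apply: le_trans (ler_pM _ _ (h_le m) xle) _; rewrite ?(abs_ge0 absP) //.
rewrite mulrA -[rho ^+ m]/(rho ^ m%:Z) -expfzDr ?gt_eqF //.
by rewrite (_ : m%:Z + _ = k%:Z) //; lia.
Qed.

(** Cramer's rule treats only the first n positions, through the coefficients of T^(k - ix) with 1
    <= k <= n. From then on s_l + ix = l + 1, and h_0 = 1 makes the system triangular: x(s_l) is
    expressed by the earlier x(s_j). *)
Lemma on_le_of_off_le X : 0 <= X -> off_le X -> on_le X.
Proof.
move=> X0 off.
have small l : (l < n)%N -> abs (x (s l)) <= rho ^ (s l + ix) * X.
  move=> ln; pose c : 'rV[K]_n := \row_j x (s j).
  pose M := \matrix_(i < n, j < n) (zseries_of_ps h ((nth 0%N kappa i)%:Z - i%:Z + j%:Z) : K).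
  have idx i j : (nth 0%N kappa i)%:Z - i%:Z + j%:Z = j.+1%:Z - (s i + ix).
    by rewrite sE; lia.
  (* Row i belongs to the unknown x(s_i), column j to the coefficient of T^(j + 1 - ix). Since j + 1
     - (s_j + ix) = kappa_(j+1), the weights multiply to rho^|kappa|. *)
  have := @cramer_bound _ _ _ absP n M c (fun j => rho ^ j.+1%:Z)
    (fun i => rho ^ (- (s i + ix))) X X0 _ _ _ _ _ (Ordinal ln).
  rewrite mxE /= => H; rewrite mulrC -[rho ^ (s l + ix)]invrK invr_expz.
  apply: H => [i|i|i j||j].
  - exact: exprz_gt0.
  - exact: exprz_gt0.
  - rewrite mxE idx -expfzDr ?gt_eqF // addrC; exact: abs_zseries_of_ps_le.
  - rewrite -[M]/(\matrix_(i < n, j < n) _) schur_h -big_split /=.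
    rewrite (eq_bigr (fun i : 'I_n => rho ^+ nth 0%N kappa i)) => [|i _].
      by rewrite prodrXr sumnE (big_nth 0%N) big_mkord.
    by rewrite -expfzDr ?gt_eqF // sE [RHS]exprnP; congr (rho ^ _); lia.
  - rewrite mxE.
    rewrite (eq_bigr (fun i : 'I_n =>
      (zseries_of_ps h (j.+1%:Z - (s i + ix)) : K) * x (s i))) => [|i _].
      apply: partial_sum_le => // i ni; rewrite s_big //; have := ltn_ord j; lia.
    by rewrite !mxE idx mulrC.
elim/ltn_ind => l IH; have [/small//|nl] := ltnP l n.
have := @partial_sum_le X l.+1 l.+1 X0 off isT _; rewrite big_ord_recr /=.
rewrite s_big // subrr /= h0 mul1r => H.
set S := \sum_(j < l) _ in H.
rewrite -[X in abs X](addKr S) addrC; apply: (absB_le absP).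
  by apply: H => j lj; rewrite s_big; lia.
apply: (abs_sum_le absP) => [|j _]; first by rewrite mulr_ge0 ?exprz_ge0 ?(ltW rho0).
rewrite (absM absP); apply: le_trans (ler_pM _ _ (abs_zseries_of_ps_le _) (IH j (ltn_ord j))) _;
  rewrite ?(abs_ge0 absP) //.
by rewrite mulrA -expfzDr ?gt_eqF // subrK.
Qed.

Lemma off_le_contract X : 0 <= X -> on_le X -> off_le (rho * X).
Proof.
move=> X0 on t st.
have b0 : 0 <= rho ^ (t + ix) * (rho * X).
  by rewrite !mulr_ge0 ?exprz_ge0 ?(ltW rho0).
apply: (abs_le_eps _ b0) => d d0; have [N HN] := xv d0.
have := HN N (leqnn _) t; set u := \sum_(j < N) _ => ux.
have -> : x t = u t - (u - x) t :> K by rewrite !fctE subKr.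
apply: (absB_le absP); last by rewrite le_max ux orbT.
rewrite le_max; apply/orP; left.
rewrite [X in abs X](_ : _ = \sum_(j < N) (x (s j) : K) * v j t); last first.
  by rewrite /u fct_sumE.
apply: (abs_sum_le absP) => // j _; rewrite (absM absP).
have := st j; rewrite neq_lt => /orP[/v_deg ->|tj]; first by rewrite (abs0 absP) mulr0.
apply: le_trans (ler_pM _ _ (on j) (v_le j t)) _; rewrite ?(abs_ge0 absP) //.
rewrite mulr1 mulrA; apply: ler_wpM2r => //.
(* The integers t < s_j differ by at least 1, which pays for the factor rho. *)
rewrite -[X in _ * X]expr1z -expfzDr ?gt_eqF //; apply: exprz_anti; lia.
Qed.

Lemma loop_kernel_trivial : x = 0.
Proof.
have C0 : 0 <= C by apply: le_trans (xC 0); exact: abs_ge0 absP _.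
(* A position t that is not a degree has t + ix <= n, hence rho^(t + ix) >= rho^n: a finite starting
   bound. *)
pose X0 := C / rho ^+ n.
have X00 : 0 <= X0 by rewrite divr_ge0 ?exprn_ge0 ?(ltW rho0).
have rX m : 0 <= rho ^+ m * X0 by rewrite mulr_ge0 ?exprn_ge0 ?(ltW rho0).
have off m : off_le (rho ^+ m * X0).
  elim: m => [|m IH].
    rewrite expr0 mul1r => t st; apply: le_trans (xC t) _.
    have tn : t + ix <= n%:Z.
      rewrite leNgt; apply/negP => nt.
      have tE : t + ix = absz (t + ix)%R by lia.
      have := s_big (j := (absz (t + ix)%R).-1) _; have := st (absz (t + ix)%R).-1; lia.
    have := exprz_anti tn; rewrite -exprnP => rn.
    rewrite /X0 mulrCA ler_peMr // ler_pdivlMr ?exprn_gt0 //.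
    by rewrite mul1r.
  by rewrite exprS -mulrA; apply: off_le_contract => //; exact: on_le_of_off_le.
apply/funext => t; apply: (eq0_abs_le absP) => e e0.
have rt0 : 0 <= X0 * rho ^ (t + ix) by rewrite mulr_ge0 ?exprz_ge0 ?(ltW rho0).
have [N /(_ N (leqnn _)) HN] := rho_pow_small rt0 e0; apply: le_trans HN.
rewrite mulrA mulrC; have [[j <-]|noj] := pselect (exists j, s j = t).
  exact: on_le_of_off_le.
by apply: off => j; apply/eqP => jt; apply: noj; exists j.
Qed.

End LoopAction.

(** * Expansion along the standard basis and transversality *)

Section AlgebraicPart.
Variables (R : realType) (K : fieldType) (abs : K -> R).
Hypotheses (absP : nonarch_absval abs) (Kcomplete : abs_complete abs).

Lemma has_degree_of_bound (u : zseries K) (B : int) : u <> 0 ->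
  (forall j, B < j -> u j = 0) -> exists d, has_degree u d.
Proof.
move=> u0 uB.
have exm : exists m : nat, (u (B - m%:Z) : K) != 0.
  apply: contrapT => no; apply: u0; apply/funext => t.
  have [tB|/uB//] := leP t B; apply/eqP; apply: contrapT => /negP ut.
  by apply: no; exists (absz (B - t)%R); rewrite (_ : B - _ = t) //; lia.
case: (ex_minnP exm) => m um m_min; exists (B - m%:Z); split; first exact/eqP.
move=> j jm; have [jB|/uB//] := leP j B; apply/eqP; apply: contrapT => /negP uj.
have := m_min (absz (B - j)%R); rewrite (_ : B - _ = j); last by lia.
by move=> /(_ uj); lia.
Qed.

(** Without an enumeration [deg_enum] would be its default 0, and [kappa_of V j] would grow with j
    instead of being eventually 0. *)
Lemma deg_enumP (V : set (zseries K)) (kappa : seq nat) :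
  (forall j, kappa_of V j = (nth 0%N kappa j)%:Z) ->
  (forall i j, (i < j)%N -> deg_enum V i < deg_enum V j) /\
  range (deg_enum V) = degrees V.
Proof.
move=> kV; rewrite /deg_enum; set P := [set s : nat -> int | _].
have [exP|noP] := pselect (exists s, P s); first exact: (xgetPex (fun=> 0) exP).
have dE : deg_enum V = fun=> 0 by apply: xgetPN => s Ps; apply: noP; exists s.
have := kV (size kappa); have := kV (size kappa).+1.
by rewrite /kappa_of dE !nth_default //; lia.
Qed.

(** The partial sums are Cauchy, as x(s_j) tends to 0 and the v_j are integral, so they have a limit
    l in W. The difference x - l vanishes at every s_j; were it nonzero, it would be an algebraic
    element of W whose degree is one of the s_j. *)
Lemma alg_part_expansion W (v : nat -> zseries K) (kappa : seq nat) (x : zseries K) :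
  Gr_an abs W -> standard_basis (alg_part W) v -> (forall i j, abs (v i j) <= 1) ->
  (forall j, kappa_of (alg_part W) j = (nth 0%N kappa j)%:Z) -> W x ->
  ball_cvg (zball abs)
    (fun N => \sum_(j < N) (x (deg_enum (alg_part W) j) : K) *: v j) x.
Proof.
move=> GW [[Vv _ _] vdeg vmon vred] v1 kV Wx.
have [s_inc s_range] := deg_enumP kV.
set s := deg_enum (alg_part W) in vdeg vmon vred s_inc s_range *.
set ix := gr_index (alg_part W).
have sE j : s j = j.+1%:Z - ix - (nth 0%N kappa j)%:Z.
  by have := kV j; rewrite /kappa_of -/s -/ix; lia.
set u := fun N => _.
have Wu N : W (u N).
  rewrite /u; elim: N => [|N IH]; first by rewrite big_ord0; exact: Gr_an0 absP _ GW.
  rewrite big_ord_recr /= addrC; apply: (Gr_an_lin absP) => //.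
  by have [] := Vv N.
have uS N : u N.+1 = u N + (x (s N) : K) *: v N by rewrite /u big_ord_recr.
have xlim e : 0 < e -> exists N, forall j, (N <= j)%N -> abs (x (s j)) <= e.
  move=> e0; have /(HspaceP absP)[_ xlim] := Gr_an_sub GW Wx.
  (* From [size kappa] on, s_j = j + 1 - ix; the extra |ix| makes s_j a natural number at least
     N. *)
  have [N HN] := xlim e e0; exists (N + size kappa + absz ix)%N => j Nj.
  have -> : s j = (absz (s j))%:Z by rewrite sE nth_default; lia.
  by apply: HN; rewrite sE nth_default; lia.
have ucau : ball_cauchy (zball abs) u.
  move=> e e0; have [N HN] := xlim e e0; exists N.
  have uN m : (N <= m)%N -> zball abs e (u m - u N).
    move=> /subnKC <-; elim: (m - N)%N => [|k IH].
      by rewrite addn0 subrr => i; rewrite (abs0 absP) ltW.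
    rewrite addnS uS addrAC => i; apply: (absD_le absP); first exact: IH.
    rewrite [X in abs X](_ : _ = (x (s (N + k)%N) : K) * v (N + k)%N i) //.
    rewrite (absM absP) -[e]mulr1; apply: ler_pM; rewrite ?(abs_ge0 absP) //.
    by apply: HN; exact: leq_addr.
  move=> m n Nm Nn; have -> : u m - u n = (u m - u N) - (u n - u N).
    by rewrite opprB addrA subrK.
  by apply: (zballB absP); exact: uN.
have [l Wl ul] := Gr_an_complete absP Kcomplete GW Wu ucau.
suff <- : l = x by [].
have us i N : (i < N)%N -> u N (s i) = x (s i) :> K.
  move=> iN; rewrite /u fct_sumE (bigD1 (Ordinal iN)) //= big1 ?addr0.
    by rewrite [LHS](_ : _ = (x (s i) : K) * v i (s i)) // vmon mulr1.
  move=> j ji; rewrite [LHS](_ : _ = (x (s j) : K) * v j (s i)) //.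
  have [ij|ij|ij] := ltngtP j i; last by rewrite -val_eqE /= ij eqxx in ji.
    by have [_ ->] := vdeg j; rewrite ?mulr0 // s_inc.
  by rewrite vred ?mulr0.
pose z := -1 *: l + x.
have zs i : z (s i) = 0.
  apply: (eq0_abs_le absP) => e e0; have [N HN] := ul e e0.
  have := HN (maxn N i.+1) (leq_maxl _ _) (s i).
  by rewrite !fctE us ?leq_maxr // /z scaleN1r !fctE addrC.
apply/eqP; rewrite eq_sym -subr_eq0 addrC -scaleN1r -/z; apply/eqP.
apply: contrapT => z0.
have Wz : W z by exact: (Gr_an_lin absP).
(* Beyond this bound every position is a degree, so z is a Laurent series in 1/T. *)
have zB j : (size kappa)%:Z - ix < j -> z j = 0.
  move=> jB; have -> : j = s (absz (j + ix)%R).-1 by rewrite sE nth_default; lia.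
  exact: zs.
have [d zd] := has_degree_of_bound z0 zB.
have : degrees (alg_part W) d by exists z => //; split=> //; exists ((size kappa)%:Z - ix).
by rewrite -s_range => -[i _ si]; have [] := zd; rewrite -si zs.
Qed.

Lemma loop_transversal (f : nat -> K) rho kappa :
  0 < rho < 1 -> f 0%N = 1 -> (forall n, abs (f n) <= rho ^+ n) ->
  abs (schur kappa (zseries_of_ps f)) = rho ^+ sumn kappa ->
  forall W, Gr_an abs W -> strictly_integral abs (alg_part W) ->
  (forall j, kappa_of (alg_part W) j = (nth 0%N kappa j)%:Z) ->
  alg_part (loop_act abs (zseries_of_ps f) W) `&`
    (shiftT (- gr_index (alg_part W)) @` taylor (K:=K)) = [set 0].
Proof.
move=> /andP[r0 r1] f0 fr schurf W GW [v stdv v1] kV.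
set ix := gr_index (alg_part W).
have f0E : mulH abs (zseries_of_ps f) 0 = 0 by exact: (mulH0 absP Kcomplete r0 r1 fr).
apply/seteqP; split => [y [[[x Wx <-] _] [t tay yt]]|_ ->] /=.
  suff -> : x = 0 by [].
  have [s_inc _] := deg_enumP kV.
  have /(HspaceP absP)[[C xC] _] := Gr_an_sub GW Wx.
  have sE j : deg_enum (alg_part W) j + ix = j.+1%:Z - (nth 0%N kappa j)%:Z.
    by have := kV j; rewrite /kappa_of -/ix; lia.
  apply: (loop_kernel_trivial absP Kcomplete r0 r1 fr s_inc sE schurf f0 xC _ v1).
  - by move=> k kix; rewrite -yt /shiftT tay //; lia.
  - by move=> l i li; have [_ ->] := stdb_degree stdv l.
  - exact: (alg_part_expansion GW stdv v1 kV).
split; last first.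
  by exists 0.
split; first by exists 0 => //; exact: Gr_an0 absP _ GW.
by exists 0.
Qed.

End AlgebraicPart.

(** * The product of several loops *)

Section MultiLoop.
Variables (R : realType) (p : nat) (Qp : fieldType) (absQ : Qp -> R).
Hypotheses (p_prime : prime p) (QpP : padic_completion p absQ).
Variables (K : fieldExtType Qp) (abs : K -> R).
Hypothesis absP : absval_extension absQ abs.
Let absKP := ext_absval absP.

Lemma ps_h0 (pi : K) : ps_h p pi 0%N = 1.
Proof. by rewrite (ps_h_small p_prime QpP) ?prime_gt0 // expr0 fact0 divr1. Qed.

Variables (g : nat) (pi : seq K) (rho : R).
Hypotheses (rho_ge0 : 0 <= rho) (rho_lt1 : rho < 1)
  (rhoE : rho ^+ g.+1 = abs pi`_g)
  (pi_le : forall i, (i <= g)%N -> abs pi`_i <= abs pi`_g).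

(** There are g + 1 loops here, numbered from 0. The last one is split off because it alone
    contributes a linear term in degree g + 1. *)
Lemma ps_hmuE : ps_hmu p (iota 1 g.+1) pi = ps_mul
  (\big[@ps_mul K/@ps_one K]_(i < g) ps_inflate i.+1 (ps_h p pi`_i))
  (ps_inflate g.+1 (ps_h p pi`_g)).
Proof.
rewrite /ps_hmu size_iota big_ord_recr /=; congr ps_mul; last first.
  by rewrite -[1%N :: iota 2 g]/(iota 1 g.+1) nth_iota.
apply: eq_bigr => i _ /=; rewrite -[1%N :: iota 2 g]/(iota 1 g.+1) nth_iota //.
by rewrite ltnS ltnW.
Qed.

Lemma ps_hmu0 : ps_hmu p (iota 1 g.+1) pi 0%N = 1.
Proof.
have infl m (c : K) : ps_inflate m (ps_h p c) 0%N = 1 by rewrite /ps_inflate dvdn0 div0n ps_h0.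
rewrite ps_hmuE /ps_mul big_ord1 /= infl mulr1.
apply: (big_ind (fun f : nat -> K => f 0%N = 1)) => // f1 f2 f10 f20.
by rewrite /ps_mul big_ord1 f10 f20 mulr1.
Qed.

(** In the factor in T^(i+1), the coefficient of T^((i+1)q) is at most |pi_i|^q, and |pi_i| <=
    rho^(g+1) <= rho^(i+1) because i <= g. *)
Lemma abs_ps_hmu n : abs (ps_hmu p (iota 1 g.+1) pi n) <= rho ^+ n.
Proof.
have infl i : (i <= g)%N ->
    forall n, abs (ps_inflate i.+1 (ps_h p pi`_i) n) <= rho ^+ n.
  move=> ig; apply: (abs_ps_inflate_le absKP (t := abs pi`_i)) => //.
  - exact: abs_ge0 absKP _.
  - apply: le_trans (pi_le ig) _; rewrite -rhoE ler_wiXn2l // ltW //.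
  - exact: (abs_ps_h p_prime QpP absP).
rewrite ps_hmuE; apply: (abs_ps_mul_le absKP) => //; last exact: infl.
apply: (big_ind (fun f => forall m, abs (f m) <= rho ^+ m)).
- by move=> m; exact: (abs_ps_one_le absKP).
- by move=> f1 f2 H1 H2; exact: (abs_ps_mul_le absKP).
- by move=> i _; apply: infl; exact: ltnW.
Qed.

Lemma abs_ps_hmu_top : abs (ps_hmu p (iota 1 g.+1) pi g.+1) = rho ^+ g.+1.
Proof.
set t := abs pi`_g; have t0 : 0 <= t := abs_ge0 absKP _.
have t1 : t < 1 by rewrite /t -rhoE exprn_ilt1.
rewrite ps_hmuE; set B := \big[_/_]_(i < g) _; set G := ps_inflate _ _.
have [B0 _ Bg] : quadratic_at abs g.+1 t B.
  apply: (big_ind (quadratic_at abs g.+1 t)).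
  - exact: (quadratic_at_one absKP).
  - by move=> f1 f2; apply: (quadratic_at_mul absKP) => //; exact: ltW.
  - move=> i _; apply: (quadratic_at_inflate absKP) => //.
    + exact: ltn_ord.
    + exact: ltW.
    + exact: ps_h0.
    + move=> n; apply: le_trans (abs_ps_h p_prime QpP absP _ _) _.
      by rewrite lerXn2r ?nnegrE ?(abs_ge0 absKP) // pi_le // ltnW.
have G0 : G 0%N = 1 by rewrite /G /ps_inflate dvdn0 div0n ps_h0.
have Gg : G g.+1 = pi`_g.
  rewrite /G /ps_inflate dvdnn divnn (ps_h_small p_prime QpP) ?prime_gt1 //.
  by rewrite expr1 divr1.
have Gm m : (0 < m < g.+1)%N -> G m = 0.
  move=> /andP[m0 mg]; rewrite /G /ps_inflate ifF //.
  by apply/negP => /(dvdn_leq m0); rewrite leqNgt mg.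
(* No mixed products: the last factor has no terms strictly between degrees 0 and g + 1. *)
have -> : ps_mul B G g.+1 = pi`_g + B g.+1.
  rewrite /ps_mul big_ord_recr big_ord_recl /= subnn G0 mulr1 subn0 B0 mul1r Gg.
  rewrite big1 ?addr0 // => i _; rewrite Gm ?mulr0 //= /bump /=.
  by have := ltn_ord i; lia.
(* Strict dominance t^2 < t requires t > 0. *)
rewrite rhoE -/t; have [t00|tpos] := eqVneq t 0.
  apply/eqP; rewrite t00 eq_le (abs_ge0 absKP) andbT.
  by apply: (absD_le absKP); rewrite -?/t ?t00 //; apply: le_trans Bg _; rewrite t00 expr0n.
apply: (absD_dominant absKP); apply: le_lt_trans Bg _.
by rewrite expr2 gtr_pMl // lt_def tpos.
Qed.

End MultiLoop.

(** The value rho = 0 occurs only in the second case, with pi_g = 0. Then all pi_i vanish and h = 1,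
    and the intersection contains the first standard basis vector, of degree 1 - i - g <= -i where i
    is the index. Hence transversality is asserted for 0 < rho. *)
Theorem proposition3p6 (R : realType) (p : nat) (p_prime : prime p)
    (Qp : fieldType) (absQ : Qp -> R) (QpP : padic_completion p absQ)
    (K : fieldExtType Qp) (abs : K -> R) (absP : absval_extension absQ abs)
    (h : zseries K) (rho : R) (kappa : seq nat) :
  (exists pi : K,
    [/\ abs pi < 1 /\ pi <> 0,
        h = zseries_of_ps (ps_h p pi),
        rho = abs pi,
        is_partition kappa &
        (nth 0 kappa 0 + size kappa <= p)%N])
  \/
  (exists (g : nat) (pi : g.-tuple K),
    [/\ (0 < g < p)%N,
        forall i : nat, (i < g)%N -> abs pi`_i < 1 /\ abs pi`_i <= abs pi`_g.-1,
        h = zseries_of_ps (ps_hmu p (iota 1 g) pi),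
        rho = abs pi`_g.-1 `^ (g%:R)^-1 &
        kappa = [:: g]]) ->
  [/\ Gamma_plus abs h /\ Gamma_rho abs rho h,
      abs (schur kappa h) = rho ^+ sumn kappa &
      0 < rho ->
      forall W : set (zseries K), Gr_an abs W ->
        strictly_integral abs (alg_part W) ->
        (forall j : nat, kappa_of (alg_part W) j = (nth 0%N kappa j)%:Z) ->
        alg_part (loop_act abs h W) `&`
          (shiftT (- gr_index (alg_part W)) @` taylor (K:=K)) = [set 0]].
Proof.
have absKP := ext_absval absP.
have Kcomplete := ext_complete QpP absP.
suff main f : (forall n, abs (f n) <= rho ^+ n) -> f 0%N = 1 -> 0 <= rho < 1 ->
    abs (schur kappa (zseries_of_ps f)) = rho ^+ sumn kappa ->
    h = zseries_of_ps f -> [/\ Gamma_plus abs h /\ Gamma_rho abs rho h,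
      abs (schur kappa h) = rho ^+ sumn kappa &
      0 < rho ->
      forall W : set (zseries K), Gr_an abs W ->
        strictly_integral abs (alg_part W) ->
        (forall j : nat, kappa_of (alg_part W) j = (nth 0%N kappa j)%:Z) ->
        alg_part (loop_act abs h W) `&`
          (shiftT (- gr_index (alg_part W)) @` taylor (K:=K)) = [set 0]].
  move=> [[pi [[pi1 pi0] hE rhoE kap kp]]|[g [pi [/andP[g0 gp] pile hE rhoE kapE]]]].
    apply: (main (ps_h p pi)) => //.
    - by move=> n; rewrite rhoE; exact: (abs_ps_h p_prime QpP absP).
    - exact: (ps_h0 p_prime QpP).
    - by rewrite rhoE (abs_ge0 absKP).
    - have unit n : (0 < n < p)%N -> abs n%:R = 1.
        move=> /andP[n0 np]; rewrite (ext_abs_nat absP) (padic_abs_unit p_prime QpP) //.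
        by apply/negP => /(dvdn_leq n0); rewrite leqNgt np.
      rewrite rhoE; apply: (abs_schur_exp absKP unit _ _ _ kp); first exact/eqP.
        by move=> n; exact: (ps_h_small p_prime QpP).
      by case/andP: kap.
  case: g g0 gp pi pile hE rhoE kapE => // g _ gp pi pile hE rhoE kapE.
  have [pg1 _] := pile g (ltnSn g).
  have pg0 : 0 <= abs pi`_g := abs_ge0 absKP _.
  have r0 : 0 <= rho by rewrite rhoE powR_ge0.
  have rE : rho ^+ g.+1 = abs pi`_g.
    by rewrite rhoE /= -powR_mulrn ?powR_ge0 // -powRrM mulVf ?powRr1 // pnatr_eq0.
  have r1 : rho < 1.
    rewrite ltNge; apply/negP => r1; have := exprn_ege1 g.+1 r1.
    by rewrite rE leNgt pg1.
  have pi_le i : (i <= g)%N -> abs pi`_i <= abs pi`_g by move=> ig; have [] := pile i ig.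
  have hb := abs_ps_hmu p_prime QpP absP r0 r1 rE pi_le.
  apply: (main (ps_hmu p (iota 1 g.+1) pi)) => //.
  - exact: (ps_hmu0 p_prime QpP).
  - by rewrite r0.
  - rewrite kapE /schur det_mx11 mxE [sumn _]addn0.
    rewrite [X in zseries_of_ps _ X](_ : _ = g.+1%:Z); last by rewrite /=; lia.
    exact: (abs_ps_hmu_top p_prime QpP absP).
move=> fr f0 r01 schurf ->; split=> //.
  exact: (Gamma_zseries_of_ps absKP).
move=> rpos; apply: (loop_transversal absKP Kcomplete) => //.
by case/andP: r01 => _ ->; rewrite rpos.
Qed.
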